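(* Let $m\ge2$, let $\Omega\subset\mathbb{R}^m$ be a body with a piecewise $C^1$ boundary, and let $\alpha\in\mathbb{R}$ be such that $Mm^{(\alpha)}(\Omega)$ exists (i.e. the extreme value defining it is attained). Suppose $\Omega$ has the same volume as a ball $B\subset\mathbb{R}^m$. Then $Mm^{(\alpha)}(\Omega)\ge Mm^{(\alpha)}(B)$ if $\alpha>m$, and $Mm^{(\alpha)}(\Omega)\le Mm^{(\alpha)}(B)$ if $\alpha\le m$, where the equalities hold if and only if $\Omega$ is a ball.
   Context: A body is a compact subset of $\mathbb{R}^m$ that is the closure of its interior. $\mu$ is Lebesgue measure on $\mathbb{R}^m$, $B_\varepsilon(x)$ is the ball with center $x$ and radius $\varepsilon$, and $A(S^{m-1})=2\pi^{m/2}/\Gamma(m/2)$. The (renormalized) potential $V^{(\alpha)}_\Omega$ ($\alpha\in\mathbb{R}$) is defined as follows. (i) If $\alpha\le 0$ and $x\in\operatorname{int}\Omega$: for $\alpha<0$, $$V^{(\alpha)}_\Omega(x)=\lim_{\varepsilon\to+0}\left(\int_{\Omega\setminus B_\varepsilon(x)}|x-y|^{\alpha-m}\,d\mu(y)-\frac{A(S^{m-1})}{-\alpha}\cdot\frac1{\varepsilon^{-\alpha}}\right),$$ and for $\alpha=0$, $$V^{(0)}_\Omega(x)=\lim_{\varepsilon\to+0}\left(\int_{\Omega\setminus B_\varepsilon(x)}|x-y|^{-m}\,d\mu(y)-A(S^{m-1})\log\frac1\varepsilon\right).$$ (ii) If $\alpha>0$ or $x\notin\Omega$: $V^{(\alpha)}_\Omega(x)=\int_{\Omega}|x-y|^{\alpha-m}\,d\mu(y)$.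 The log potential is $V_\Omega^{\log}(x)=-\int_\Omega\log|x-y|\,d\mu(y)$. $Mm^{(\alpha)}(\Omega)$ denotes: the minimum value of $V_\Omega^{(\alpha)}$ on $\mathbb{R}^m$ if $\alpha>m$; the maximum value of $V_\Omega^{\log}$ on $\mathbb{R}^m$ if $\alpha=m$; the maximum value of $V_\Omega^{(\alpha)}$ on $\mathbb{R}^m$ if $0<\alpha<m$; the maximum value of $V_\Omega^{(\alpha)}$ restricted to $\operatorname{int}\Omega$ if $\alpha\le0$. *)

(* Defs.v *)
From HB Require Import structures.
From mathcomp Require Import all_boot all_order all_algebra.
From mathcomp Require Import all_classical all_reals all_analysis.
Set Implicit Arguments.
Unset Strict Implicit.
Unset Printing Implicit Defensive.
Import Order.TTheory GRing.Theory Num.Theory.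
Import numFieldNormedType.Exports.

Local Open Scope classical_set_scope.
Local Open Scope ring_scope.

(* R^n is 'rV[R]_n. Its library topology comes from the sup norm, hence is the
   Euclidean one; its sigma-algebra is generated by the n coordinates, with
   Borel sets on the coordinate axes, hence is the Borel one. *)
Section rV_measurable.
Context {R : realType} {n : nat}.

Let coord (i : 'I_n) (x : 'rV[R]_n) : measurableTypeR R := x ord0 i.

Let rV_set0 : g_sigma_preimage coord set0.
Proof. exact: sigma_algebra0. Qed.

Let rV_setC A : g_sigma_preimage coord A -> g_sigma_preimage coord (~` A).
Proof. exact: sigma_algebraC. Qed.

Let rV_bigcup (F : (set 'rV[R]_n)^nat) :
  (forall i, g_sigma_preimage coord (F i)) ->
  g_sigma_preimage coord (\bigcup_i F i).
Proof. exact: sigma_algebra_bigcup. Qed.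

HB.instance Definition _ := @isMeasurable.Build
  (measure_tuple_display (sigma_display (@ocitv R))) 'rV[R]_n
  (g_sigma_preimage coord) rV_set0 rV_setC rV_bigcup.

End rV_measurable.

Lemma measurable_coord_rV (R : realType) n (i : 'I_n) :
  measurable_fun [set: 'rV[R]_n] (fun x => x ord0 i : measurableTypeR R).
Proof.
move=> _ Y mY; rewrite setTI; apply: sub_sigma_algebra => /=.
rewrite -bigcup_seq/=; exists i => /=; first by rewrite mem_index_enum.
by exists Y => //; rewrite setTI.
Qed.

Lemma measurable_fun_rV (R : realType) n d (T : measurableType d)
    (f : T -> 'rV[R]_n) :
  (forall i, measurable_fun setT (fun t => f t ord0 i : measurableTypeR R)) ->
  measurable_fun setT f.
Proof.
move=> mf _ Y mY.
pose F := [set A : set 'rV[R]_n | measurable (f @^-1` A)].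
suff : F Y by rewrite setTI.
apply: mY; split.
- split; rewrite /F/=.
  + by rewrite preimage_set0; exact: measurable0.
  + by move=> A mA; rewrite setTD preimage_setC; exact: measurableC.
  + by move=> A mA; rewrite preimage_bigcup; exact: bigcupT_measurable.
- move=> A; rewrite -bigcup_seq/= => -[i _] [B mB <-].
  rewrite /F /= setTI -comp_preimage -[X in measurable X]setTI.
  exact: mf.
Qed.

Section lebesgue_rVS.
Context {R : realType} {n : nat}.

Definition rV_cons (p : measurableTypeR R * 'rV[R]_n) : 'rV[R]_n.+1 :=
  row_mx (p.1%:M : 'M[R]_1) p.2.

Lemma measurable_rV_cons : measurable_fun setT rV_cons.
Proof.
apply: measurable_fun_rV => i.
rewrite (_ : (fun _ => _) =
    fun p : measurableTypeR R * 'rV[R]_n => match @fintype.split 1 n i with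
      | inl _ => p.1
      | inr j => p.2 ord0 j
    end); last first.
  apply/funext => p; rewrite mxE; case: fintype.split => // j.
  by rewrite (ord1 j) mxE eqxx mulr1n.
case: fintype.split => j; first exact: measurable_fst.
apply: (@measurableT_comp _ _ _ _ _ _ (fun x : 'rV[R]_n => x ord0 j)).
  exact: measurable_coord_rV.
exact: measurable_snd.
Qed.

#[local] Hint Resolve measurable_rV_cons : core.

Definition lebesgue_rVS (mu : {sigma_finite_measure set 'rV[R]_n -> \bar R}) :
    set 'rV[R]_n.+1 -> \bar R :=
  pushforward (@lebesgue_measure R \x mu)%E rV_cons.

Variable mu : {sigma_finite_measure set 'rV[R]_n -> \bar R}.

Let lebesgue_rVS0 : lebesgue_rVS mu set0 = 0%E.
Proof. exact: measure0. Qed.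

Let lebesgue_rVS_ge0 A : (0 <= lebesgue_rVS mu A)%E.
Proof. exact: measure_ge0. Qed.

Let lebesgue_rVS_sigma_additive : semi_sigma_additive (lebesgue_rVS mu).
Proof. exact: measure_semi_sigma_additive. Qed.

HB.instance Definition _ := isMeasure.Build _ _ _ (lebesgue_rVS mu)
  lebesgue_rVS0 lebesgue_rVS_ge0 lebesgue_rVS_sigma_additive.

Let lebesgue_rVS_sigma_finite : sigma_finite setT (lebesgue_rVS mu).
Proof.
pose g (x : 'rV[R]_n.+1) : measurableTypeR R * 'rV[R]_n :=
  (x ord0 ord0, @rsubmx R 1 1 n x).
have gK p : g (rV_cons p) = p.
  case: p => a v; rewrite /g /rV_cons row_mxKr; congr pair.
  rewrite (_ : ord0 = lshift n (ord0 : 'I_1)); last exact: val_inj.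
  by rewrite (row_mxEl (a%:M : 'M[R]_1)) mxE eqxx mulr1n.
have mg : measurable_fun setT g.
  apply/measurable_fun_pairP; split; first exact: measurable_coord_rV.
  apply: measurable_fun_rV => i.
  rewrite (_ : (fun _ => _) = fun x : 'rV[R]_n.+1 => x ord0 (rshift 1 i)).
    exact: measurable_coord_rV.
  by apply/funext => x /=; rewrite mxE.
have /sigma_finiteP[F [TF ndF Foo]] := sigma_finiteT (@lebesgue_measure R).
have /sigma_finiteP[G [TG ndG Goo]] := sigma_finiteT mu.
exists (fun k => g @^-1` (F k `*` G k)).
  apply/esym/seteqP; split => // x _.
  have [k _ Fk] : (\bigcup_k F k) (g x).1 by rewrite -TF.
  have [l _ Gl] : (\bigcup_k G k) (g x).2 by rewrite -TG.
  exists (maxn k l) => //; split.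
  - by move: Fk; exact/subsetPset/ndF/leq_maxl.
  - by move: Gl; exact/subsetPset/ndG/leq_maxr.
move=> k; have [mFk Fk] := Foo k; have [mGk Gk] := Goo k; split.
  by rewrite -[X in measurable X]setTI; apply: mg => //; exact: measurableX.
rewrite /lebesgue_rVS /pushforward -comp_preimage.
rewrite (_ : g \o rV_cons = id); last exact/funext.
by rewrite preimage_id product_measure1E// lte_mul_pinfty// ge0_fin_numE.
Qed.

HB.instance Definition _ := Measure_isSigmaFinite.Build _ _ _
  (lebesgue_rVS mu) lebesgue_rVS_sigma_finite.

End lebesgue_rVS.

(* Lebesgue measure on the Borel sets of R^n, as the n-fold product of the
   one-dimensional one. *)
Fixpoint lebesgue_rV (R : realType) (n : nat) :
    {sigma_finite_measure set 'rV[R]_n -> \bar R} :=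
  match n with
  | 0 => dirac (0 : 'rV[R]_0)
  | n'.+1 => lebesgue_rVS (lebesgue_rV R n')
  end.

(* The library norm on 'rV[R]_n is the sup norm. *)
Definition euclid_norm (R : realType) n (x : 'rV[R]_n) : R :=
  Num.sqrt (\sum_(i < n) x ord0 i ^+ 2).

Definition euclid_ball (R : realType) n (c : 'rV[R]_n) (r : R) : set 'rV[R]_n :=
  [set y | euclid_norm (y - c) <= r].

Definition is_euclid_ball (R : realType) n (B : set 'rV[R]_n) :=
  exists (c : 'rV[R]_n) (r : R), 0 < r /\ B = euclid_ball c r.

Definition body (R : realType) n (Omega : set 'rV[R]_n) :=
  compact Omega /\ Omega = closure (interior Omega).

Definition C1_near (R : realType) m n (A : set 'rV[R]_m)
    (f : 'rV[R]_m -> 'rV[R]_n) :=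
  forall u, A u -> \forall v \near u,
    differentiable f v /\ {for v, continuous (jacobian f)}.

Definition cube (R : realType) k : set 'rV[R]_k :=
  [set u | forall i, 0 <= u ord0 i <= 1].

Definition open_cube (R : realType) k : set 'rV[R]_k :=
  [set u | forall i, 0 < u ord0 i < 1].

Arguments cube : clear implicits.
Arguments open_cube : clear implicits.

(* A parametrized C^1 patch: f is C^1 on a neighbourhood of the closed cube
   and, on the open cube, injective and immersive. Rows of the jacobian are
   indexed by the variables of f, so row_free means that the differential is
   injective. *)
Definition C1_patch (R : realType) k n (f : 'rV[R]_k -> 'rV[R]_n) :=
  [/\ C1_near (cube R k) f,
      {in open_cube R k &, injective f} &
      forall u, open_cube R k u -> row_free (jacobian f u)].

(* The boundary is a finite union of nonoverlapping (n-1)-dimensional C^1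
   patches; nonoverlapping means that the images of the open cubes are
   disjoint. *)
Definition piecewise_C1_boundary (R : realType) n (Omega : set 'rV[R]_n) :=
  exists (N : nat) (f : 'I_N -> 'rV[R]_n.-1 -> 'rV[R]_n),
    [/\ forall j, C1_patch (f j),
        closure Omega `\` interior Omega =
          \bigcup_(j in [set: 'I_N]) (f j @` cube R n.-1) &
        forall i j, i != j ->
          f i @` open_cube R n.-1 `&` f j @` open_cube R n.-1 = set0].

Section potential.
Context {R : realType}.

Definition Gamma (s : R) : R :=
  \int[@lebesgue_measure R]_(t in `]0, +oo[) (t `^ (s - 1) * expR (- t)).

(* The area of the unit sphere of R^m. *)
Definition sphere_area (m : nat) : R :=
  2 * pi `^ (m%:R / 2) / Gamma (m%:R / 2).

Variables (m : nat) (alpha : R) (Omega : set 'rV[R]_m).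

Definition riesz_integral (A : set 'rV[R]_m) (x : 'rV[R]_m) : R :=
  \int[lebesgue_rV R m]_(y in A) (euclid_norm (x - y) `^ (alpha - m%:R)).

Definition counterterm (eps : R) : R :=
  if alpha == 0 then sphere_area m * ln (1 / eps)
  else sphere_area m / (- alpha) * (1 / (eps `^ (- alpha))).

(* When alpha <= 0, no potential is attached to the boundary points of Omega;
   the value of potential there is irrelevant. *)
Definition potential (x : 'rV[R]_m) : R :=
  if (alpha <= 0) && (x \in (interior Omega : set _)) then
    lim ((riesz_integral (Omega `\` euclid_ball x eps) x - counterterm eps)
      @[eps --> 0^'+])
  else riesz_integral Omega x.

Definition log_potential (x : 'rV[R]_m) : R :=
  - \int[lebesgue_rV R m]_(y in Omega) ln (euclid_norm (x - y)).

Definition is_max_value (D : set 'rV[R]_m) (f : 'rV[R]_m -> R) (v : R) :=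
  (exists2 x, D x & f x = v) /\ forall x, D x -> f x <= v.

Definition is_min_value (D : set 'rV[R]_m) (f : 'rV[R]_m -> R) (v : R) :=
  (exists2 x, D x & f x = v) /\ forall x, D x -> v <= f x.

(* is_Mm v means that Mm^(alpha)(Omega) exists and equals v. *)
Definition is_Mm (v : R) : Prop :=
  if m%:R < alpha then is_min_value setT potential v
  else if alpha == m%:R then is_max_value setT log_potential v
  else if 0 < alpha then is_max_value setT potential v
  else is_max_value (interior Omega) potential v.

End potential.

(* Main.v *)
From HB Require Import structures.
Require Import Defs.
From mathcomp Require Import all_boot all_order all_algebra.
From mathcomp Require Import all_classical all_reals all_analysis.
From mathcomp Require Import measurable_realfun ring lra.
Import Order.TTheory GRing.Theory Num.Theory.
Import numFieldNormedType.Exports.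
Local Open Scope classical_set_scope.
Local Open Scope ring_scope.
Set Implicit Arguments.
Unset Strict Implicit.
Unset Printing Implicit Defensive.

(** Let [x] be a point where the potential of Omega takes its extreme value,
    and compare Omega with the ball of the same volume centred at [x]. With
    the sign of the kernel chosen so that it decreases with the distance for
    every exponent ([riesz_kernel]), Omega arises from that ball by removing
    points at distance at most [r] from [x], where the kernel is at least its
    value [k r] on the sphere, and by adding the same volume of points at
    distance larger than [r], where the kernel is smaller than [k r]. Hence
    the potential of Omega at [x] is the potential of the ball at its centre
    minus a nonnegative quantity ([energy_deficit]), which vanishes only if the
    two exchanged sets are null ([energy_deficit_ge0]); a body that differs
    from a ball by null sets is this ball ([body_null_eq_ball]). The value at
    the centre of a ball depends on its radius only, and the same comparison,
    applied to a ball in place of Omega, shows that the potential of a ball is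
    extreme at the centre. Both uses go through [signed_potential_deficit].

    For [alpha <= 0] the potential is a limit, and the argument needs this
    limit to exist. Once a small ball around [x] inside Omega is removed, the
    deficit no longer depends on its radius [e], so only the integral over the
    shell between the radii [e] and [r] has to be renormalized. It is computed
    in [integral_annulus], and the counterterm cancels its singular part
    exactly because [2 pi^(n/2) / Gamma(n/2)] is [n] times the volume of the
    unit ball ([sphere_areaE]). That identity is obtained by evaluating the
    integral of [exp (- |y|^2)] in two ways: as a product of one-dimensional
    Gaussian integrals, and radially.

    Radial integrals rest on one fact ([lebesgue_rV_content]): the function
    sending [y] to the volume of the ball centred at [x] through [y] pushes
    Lebesgue measure of R^n forward to Lebesgue measure on the half-line. It
    follows from the scaling law for volumes of balls, hence from the affine
    change of variables [lebesgue_rV_affine]. *)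

(** * Topology and Borel sets of Euclidean space *)

(** The sigma-algebra is generated by the coordinates, so an open set has to be
    written as a countable union of boxes: those with a rational centre and
    half-side [1 / (k + 1)] that it contains. *)
Lemma open_measurable_rV (R : realType) n (U : set 'rV[R]_n) :
  open U -> measurable U.
Proof.
move=> oU.
pose F (p : 'rV[rat]_n * nat) : set 'rV[R]_n :=
  if `[< ball (map_mx ratr p.1 : 'rV[R]_n) p.2.+1%:R^-1 `<=` U >]
  then \bigcap_(i in [set: 'I_n])
    (fun x : 'rV[R]_n => x ord0 i : measurableTypeR R) @^-1`
      ball (ratr (p.1 ord0 i) : R) p.2.+1%:R^-1
  else set0.
have e0 k : 0 < k.+1%:R^-1 :> R by rewrite invr_gt0 ltr0n.
suff -> : U = \bigcup_p F p.
  apply: countable_bigcupT_measurable; first exact: countableP.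
  move=> [q k]; rewrite /F; case: asboolP => _; last exact: measurable0.
  apply: fin_bigcap_measurable.
    have -> : [set: 'I_n] = [set` predT] by apply/seteqP; split.
    exact: finite_finpred.
  move=> i _; rewrite -[X in measurable X]setTI.
  apply: measurable_coord_rV => //.
  apply: measurable_realfun.open_measurable; exact: ball_open.
apply/seteqP; split => [x Ux|x [[q k] _]]; last first.
  rewrite /F /=; case: asboolP => // sU xq; apply: sU; split => // i j.
  by rewrite (ord1 i) mxE; exact: xq.
(* A rational centre within half the available room of [x] gives a box that
   contains [x] and stays inside [U]. *)
have /nbhs_ballP[e /= e_gt0 xU] : nbhs x U by exact: open_nbhs_nbhs.
have [k ke] : exists k, k.+1%:R^-1 < e / 2.
  have /ltr_add_invr[k] : 0 < e / 2 by rewrite divr_gt0.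
  by rewrite add0r => ?; exists k.
have /choice[q xq] (i : 'I_n) :
    exists q : rat, ball (ratr q : R) k.+1%:R^-1 (x ord0 i).
  have /rat_in_itvoo[q] : x ord0 i - k.+1%:R^-1 < x ord0 i + k.+1%:R^-1.
    by rewrite ltrBlDr -addrA ltrDl addr_gt0.
  rewrite in_itv/= => /andP[h1 h2]; exists q.
  rewrite /ball/= ltr_distlC.
  by rewrite ltrBlDr h2 -ltrBlDr h1.
exists (\row_i q i, k) => //; rewrite /F /=; case: asboolP => [_ i _|].
  by rewrite /= mxE.
case => y qy; apply: xU; split => // i j.
rewrite (ord1 i) (splitr e).
apply: (@ball_triangle _ _ (ratr (q j) : R)).
  by apply: le_ball (ball_sym (xq j)); exact: ltW.
have := qy.2 ord0 j; rewrite !mxE; apply: le_ball; exact: ltW.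
Qed.

Lemma closed_measurable_rV (R : realType) n (U : set 'rV[R]_n) :
  closed U -> measurable U.
Proof.
move=> cU; rewrite -(setCK U); apply: measurableC.
by apply: open_measurable_rV; rewrite openC.
Qed.

Section euclid.
Context {R : realType} {n : nat}.
Implicit Types (x y c : 'rV[R]_n) (r : R).

Lemma euclid_norm_ge0 x : 0 <= euclid_norm x.
Proof. exact: sqrtr_ge0. Qed.

Lemma euclid_normN x : euclid_norm (- x) = euclid_norm x.
Proof.
by rewrite /euclid_norm; under eq_bigr do rewrite mxE sqrrN.
Qed.

Lemma euclid_distC x y : euclid_norm (x - y) = euclid_norm (y - x).
Proof. by rewrite -euclid_normN opprB. Qed.

Lemma euclid_normZ r x : euclid_norm (r *: x) = `|r| * euclid_norm x.
Proof.
rewrite /euclid_norm; under eq_bigr do rewrite mxE exprMn.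
by rewrite -mulr_sumr sqrtrM ?sqr_ge0// sqrtr_sqr.
Qed.

Lemma sqr_euclid_norm x : euclid_norm x ^+ 2 = \sum_i x ord0 i ^+ 2.
Proof. by rewrite sqr_sqrtr// sumr_ge0// => i _; exact: sqr_ge0. Qed.

Lemma coord_le_euclid_norm x i : `|x ord0 i| <= euclid_norm x.
Proof.
rewrite -sqrtr_sqr ler_wsqrtr// (bigD1 i)//= lerDl sumr_ge0// => j _.
exact: sqr_ge0.
Qed.

Lemma euclid_norm_eq0 x : (euclid_norm x == 0) = (x == 0).
Proof.
apply/eqP/eqP => [x0|->].
  apply/rowP => i; rewrite mxE; apply/eqP; rewrite -normr_le0 -x0.
  exact: coord_le_euclid_norm.
by rewrite /euclid_norm big1 ?sqrtr0// => i _; rewrite mxE expr0n.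
Qed.

Lemma euclid_norm0 : euclid_norm (0 : 'rV[R]_n) = 0.
Proof. by apply/eqP; rewrite euclid_norm_eq0. Qed.

Lemma euclid_ballE c r : euclid_ball c r = [set y | euclid_norm (c - y) <= r].
Proof. by apply/funext => y; rewrite /euclid_ball /= euclid_distC. Qed.

Lemma continuous_euclid_norm : continuous (@euclid_norm R n).
Proof.
move=> x; apply: (@continuous_comp _ _ _
  (fun x : 'rV[R]_n => \sum_i x ord0 i ^+ 2) Num.sqrt).
  move: x; apply: continuous_big; first exact: add_continuous.
  move=> i _ x; apply: (@continuous_comp _ _ _
    (fun x : 'rV[R]_n => x ord0 i) (fun t => t ^+ 2)).
    exact: coord_continuous.
  exact: exprn_continuous.
exact: sqrt_continuous.
Qed.

Lemma continuous_euclid_dist c : continuous (fun y => euclid_norm (c - y)).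
Proof.
move=> x; apply: (@continuous_comp _ _ _ (fun y => c - y) (@euclid_norm R n)).
  apply: (@cvgB R _ _ (nbhs x) _ (cst c) id c x); last exact: cvg_id.
  exact: cvg_cst.
exact: continuous_euclid_norm.
Qed.

Lemma measurable_euclid_dist c :
  measurable_fun setT (fun y => euclid_norm (c - y) : measurableTypeR R).
Proof.
apply: (measurability _ (measurable_realfun.RGenOInfty.measurableE R)) => //=.
move=> _ [_ [a ->] <-].
rewrite setTI; apply: open_measurable_rV.
apply: open_comp; last exact: interval_open.
by move=> y _; exact: continuous_euclid_dist.
Qed.

Lemma closed_euclid_ball c r : closed (euclid_ball c r).
Proof.
rewrite euclid_ballE.
apply: (@preimage_closed _ _ (fun y => euclid_norm (c - y)) [set t | t <= r]).
  by move=> y _; exact: continuous_euclid_dist.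
exact: closed_le.
Qed.

Lemma measurable_euclid_ball c r : measurable (euclid_ball c r).
Proof. by apply: closed_measurable_rV; exact: closed_euclid_ball. Qed.

Lemma open_euclid_ball c r : open [set y | euclid_norm (c - y) < r].
Proof.
apply: (@open_comp _ _ (fun y => euclid_norm (c - y)) [set t | t < r]).
  by move=> y _; exact: continuous_euclid_dist.
exact: open_lt.
Qed.

Lemma interior_euclid_ball c r : 0 < r -> interior (euclid_ball c r) c.
Proof.
move=> r0; rewrite /interior nbhsE; exists [set y | euclid_norm (c - y) < r].
  split; first exact: open_euclid_ball.
  by rewrite /= subrr euclid_norm0.
by move=> y /ltW; rewrite euclid_ballE.
Qed.

Lemma nbhs_euclid_ball c (U : set 'rV[R]_n) : nbhs c U ->
  exists2 r, 0 < r & euclid_ball c r `<=` U.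
Proof.
move=> /nbhs_ballP[e /= e0 eU]; exists (e / 2); first by rewrite divr_gt0.
rewrite euclid_ballE => y cy; apply: eU; split => // i j.
rewrite (ord1 i) /ball/=.
have := coord_le_euclid_norm (c - y) j; rewrite !mxE => /le_lt_trans; apply.
by rewrite (le_lt_trans cy)// ltr_pdivrMr// ltr_pMr// ltr1n.
Qed.

Lemma compact_sub_euclid_ball (A : set 'rV[R]_n) c : compact A ->
  exists2 r, 0 < r & A `<=` euclid_ball c r.
Proof.
move=> cA.
have /compact_bounded[M [_ AM]] :
    compact ((fun y => euclid_norm (c - y)) @` A : set R^o).
  apply: continuous_compact => //; apply: continuous_subspaceT.
  exact: continuous_euclid_dist.
exists (`|M| + 1); first by rewrite ltr_pwDr.
rewrite euclid_ballE => y Ay /=; rewrite -[leLHS]ger0_norm ?euclid_norm_ge0//.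
apply: AM; first by rewrite (le_lt_trans (ler_norm _))// ltrDl.
by exists y.
Qed.

End euclid.

(** * Affine changes of variables *)

Section affine.
Context {R : realType}.
Local Open Scope ereal_scope.

Lemma measurable_affine (a b : R) :
  measurable_fun setT (fun t : measurableTypeR R => (a * t + b)%R : measurableTypeR R).
Proof. by apply: measurable_funD => //; exact: measurable_funM. Qed.

Lemma lebesgue_measure_affine (a b : R) (A : set (measurableTypeR R)) :
  (0 < a)%R -> measurable A ->
  lebesgue_measure
    ((fun t : measurableTypeR R => (a * t + b)%R : measurableTypeR R) @^-1` A) =
  a^-1%:E * lebesgue_measure A.
Proof.
move=> a0 mA; pose T : measurableTypeR R -> measurableTypeR R := fun t => (a * t + b)%R.
have mT : measurable_fun setT T by exact: measurable_affine.
pose nu : {measure set (measurableTypeR R) -> \bar R} :=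
  mscale (NngNum (ltW a0)) (pushforward lebesgue_measure T).
have : lebesgue_measure A = nu mT A.
  apply: lebesgue_measure_unique => // _ [[u v]] _ <-/=.
  rewrite /nu /mscale /pushforward /=.
  rewrite [X in _ * lebesgue_measure X](_ : _ =
    `]((u - b) / a)%R, ((v - b) / a)%R]%classic); last first.
    apply/funext => t; rewrite /T /= !in_itv/=; apply/propext.
    by rewrite ltr_pdivrMr// ler_pdivlMr// ltrBlDr lerBrDr mulrC.
  rewrite !lebesgue_measure_itv /= !lte_fin ltr_pM2r ?invr_gt0// ltrD2r.
  case: ifPn => _; last by rewrite mule0.
  by rewrite -!EFinD -EFinM; congr (_%:E); field; rewrite gt_eqF.
rewrite /nu /mscale /pushforward /= => ->.
by rewrite muleA -EFinM mulVf ?gt_eqF// mul1e.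
Qed.

Lemma ge0_integral_affine (a b : R) (f : measurableTypeR R -> \bar R) : (0 < a)%R ->
  measurable_fun setT f -> (forall t, 0 <= f t) ->
  \int[lebesgue_measure]_t f (a * t + b)%R = a^-1%:E * \int[lebesgue_measure]_t f t.
Proof.
move=> a0 mf f0.
have ai0 : (0 <= a^-1)%R by rewrite invr_ge0 ltW.
rewrite -[RHS](ge0_integral_mscale lebesgue_measure measurableT (NngNum ai0))//.
have := ge0_integral_pushforward (measurable_affine a b) lebesgue_measure measurableT mf.
rewrite preimage_setT /= => <-; last by move=> t _; exact: f0.
apply: eq_measure_integral => [|? A mA _]; first exact: measurable_affine.
exact: lebesgue_measure_affine.
Qed.

(** Induction on the dimension: the slices of the preimage of [A] are preimages
    of slices of [A], so the inner measure scales by induction and the outer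
    integral by the one-dimensional change of variables. *)
Lemma lebesgue_rV_affine n (a : R) (x : 'rV[R]_n) (A : set 'rV[R]_n) :
  (0 < a)%R -> measurable A ->
  lebesgue_rV R n ((fun v => a *: v + x)%R @^-1` A) =
  ((a ^+ n)^-1)%:E * lebesgue_rV R n A.
Proof.
move=> a0; elim: n => [|n IH] in x A *.
  move=> mA; rewrite expr0 invr1 mul1e; congr (lebesgue_rV R 0 _).
  by apply/funext => v /=; rewrite [v]thinmx0 [(_ + _)%R]thinmx0.
move=> mA.
pose A' := rV_cons @^-1` A.
have mA' : measurable A'.
  by rewrite -[X in measurable X]setTI; exact: measurable_rV_cons.
pose x0 := x ord0 ord0; pose x' : 'rV[R]_n := @rsubmx R 1 1 n x.
rewrite [LHS]/= /lebesgue_rVS /pushforward /product_measure1.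
have xE v t : (a *: @rV_cons R n (t, v) + x)%R =
    rV_cons ((a * t + x0)%R, (a *: v + x')%R).
  apply/rowP => i; rewrite /rV_cons !mxE/=.
  case: splitP => j /= ij; rewrite !mxE ?ord1 ?mulr1n /=.
    by congr (_ + x _ _)%R; apply: val_inj; rewrite /= ij (ord1 j).
  by congr (_ + x _ _)%R; apply: val_inj; rewrite /= ij.
under eq_integral => t _.
  rewrite /= (_ : xsection _ _ =
    (fun v => a *: v + x')%R @^-1` xsection A' (a * t + x0)%R); last first.
    by apply/funext => v; rewrite /= /xsection /= !in_setE /= xE.
  rewrite IH; last exact: measurable_xsection.
  over.
rewrite ge0_integralZl//=.
- rewrite (@ge0_integral_affine _ _ (fun t => lebesgue_rV R n (xsection A' t)))//.
    by rewrite muleA -EFinM exprS invfM mulrC.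
  exact: (measurable_fun_xsection (lebesgue_rV R n)).
- apply: (measurableT_comp (measurable_fun_xsection (lebesgue_rV R n) mA')).
  exact: measurable_affine.
- by rewrite lee_fin invr_ge0 exprn_ge0// ltW.
Qed.

End affine.

(** * The Gaussian integral and the volume of balls *)

Section gauss.
Context {R : realType}.
Local Open Scope ereal_scope.

Lemma measurable_gauss_rV n :
  measurable_fun setT (fun y : 'rV[R]_n => (gauss_fun (euclid_norm y))%:E).
Proof.
apply/measurable_EFinP/measurableT_comp; first exact: measurable_gauss_fun.
rewrite [X in measurable_fun _ X](_ : _ = fun y : 'rV[R]_n => euclid_norm (0 - y)%R).
  exact: measurable_euclid_dist.
by apply/funext => y; rewrite sub0r euclid_normN.
Qed.

(** The Gaussian of the Euclidean norm is the product of the Gaussians of the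
    coordinates, so Tonelli reduces to dimension one. *)
Lemma integral_gauss_rV n :
  \int[lebesgue_rV R n]_y (gauss_fun (euclid_norm y))%:E = (Num.sqrt pi ^+ n)%:E.
Proof.
elim: n => [|n IH].
  rewrite /= integral_dirac//; last exact: measurable_gauss_rV.
  by rewrite diracT mul1e euclid_norm0 /gauss_fun expr0n oppr0 expR0 expr0.
have gE (t : R) (v : 'rV[R]_n) :
    (gauss_fun (euclid_norm (rV_cons (t, v))) =
     gauss_fun t * gauss_fun (euclid_norm v))%R.
  have h0 : rV_cons (t, v) ord0 ord0 = t.
    rewrite /rV_cons (_ : ord0 = lshift n (ord0 : 'I_1)); last exact: val_inj.
    by rewrite (row_mxEl (t%:M : 'M[R]_1)) mxE eqxx mulr1n.
  have hS i : rV_cons (t, v) ord0 (lift ord0 i) = v ord0 i.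
    rewrite /rV_cons (_ : lift ord0 i = rshift 1 i); last exact: val_inj.
    by rewrite (row_mxEr (t%:M : 'M[R]_1)).
  rewrite /gauss_fun -expRD -opprD !sqr_euclid_norm big_ord_recl h0.
  by under eq_bigr do rewrite hS.
rewrite [LHS](@ge0_integral_pushforward _ _ _ _ R _ (@measurable_rV_cons R n)
  (lebesgue_measure \x lebesgue_rV R n) setT)//; last 2 first.
- exact: measurable_gauss_rV.
- by move=> y _; rewrite lee_fin gauss_fun_ge0.
rewrite preimage_setT fubini_tonelli1//; last 2 first.
- by apply: measurableT_comp; [exact: measurable_gauss_rV|exact: measurable_rV_cons].
- by move=> y; rewrite /= lee_fin gauss_fun_ge0.
rewrite /fubini_F.
under eq_integral => t _.
  under eq_integral => v _ do rewrite /= gE EFinM.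
  rewrite ge0_integralZl//; last 3 first.
  - exact: measurable_gauss_rV.
  - by move=> y _; rewrite lee_fin gauss_fun_ge0.
  - by rewrite lee_fin gauss_fun_ge0.
  rewrite IH muleC.
  over.
rewrite ge0_integralZl//; last 2 first.
- by apply/measurable_EFinP; exact: measurable_gauss_fun.
- by move=> t _; rewrite lee_fin gauss_fun_ge0.
by rewrite integralT_gauss -EFinM exprSr.
Qed.

Definition unit_ball_volume n : R := fine (lebesgue_rV R n (euclid_ball 0 1)).

Lemma lebesgue_rV_euclid_ball_scale n (x : 'rV[R]_n) r : (0 < r)%R ->
  lebesgue_rV R n (euclid_ball x r) = (r ^+ n)%:E * lebesgue_rV R n (euclid_ball 0 1).
Proof.
move=> r0.
have -> : euclid_ball 0 1 = (fun v : 'rV[R]_n => r *: v + x)%R @^-1` euclid_ball x r.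
  apply/funext => v; rewrite /euclid_ball /= addrK euclid_normZ subr0 gtr0_norm//.
  by rewrite mulrC -ler_pdivlMr// divff ?gt_eqF.
rewrite lebesgue_rV_affine//; last exact: measurable_euclid_ball.
by rewrite muleA -EFinM divff ?mul1e// expf_neq0// gt_eqF.
Qed.

(** The unit ball has finite volume because the Gaussian is at least [exp (-1)]
    on it. *)
Lemma unit_ball_volumeE n :
  lebesgue_rV R n (euclid_ball 0 1) = (unit_ball_volume n)%:E.
Proof.
rewrite fineK// ge0_fin_numE//.
have : (expR (- 1))%:E * lebesgue_rV R n (euclid_ball 0 1) <= (Num.sqrt pi ^+ n)%:E.
  rewrite -integral_gauss_rV -integral_cst; last exact: measurable_euclid_ball.
  apply: (@le_trans _ _ (\int[lebesgue_rV R n]_(y in euclid_ball 0 1)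
                           (gauss_fun (euclid_norm y))%:E)).
    apply: ge0_le_integral => //.
    - exact: measurable_euclid_ball.
    - by move=> y _; rewrite lee_fin expR_ge0.
    - by apply: measurable_funTS; exact: measurable_gauss_rV.
    - move=> y; rewrite /euclid_ball/= subr0 => y1.
      rewrite /gauss_fun lee_fin ler_expR lerN2.
      by rewrite expr_le1// euclid_norm_ge0.
  apply: ge0_subset_integral => //.
  - exact: measurable_euclid_ball.
  - exact: measurable_gauss_rV.
  - by move=> y _; rewrite lee_fin gauss_fun_ge0.
move: (measure_ge0 (lebesgue_rV R n) (euclid_ball 0 1)).
case: (lebesgue_rV R n (euclid_ball 0 1)) => [r _ _|_|//]; first exact: ltry.
by rewrite gt0_muley ?lte_fin ?expR_gt0.
Qed.

(** Otherwise all balls, hence the whole space, would be null, and the Gaussian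
    integral would vanish. *)
Lemma unit_ball_volume_gt0 n : (0 < unit_ball_volume n)%R.
Proof.
rewrite lt_neqAle fine_ge0// andbT eq_sym; apply/eqP => w0.
have ball0 k : lebesgue_rV R n (euclid_ball 0 k.+1%:R) = 0.
  by rewrite lebesgue_rV_euclid_ball_scale ?ltr0n// unit_ball_volumeE w0 mule0.
have : lebesgue_rV R n setT = 0.
  have -> : [set: 'rV[R]_n] = \bigcup_k euclid_ball 0 k.+1%:R.
    apply/seteqP; split => // y _; exists (Num.truncn (euclid_norm y)) => //.
    by rewrite /euclid_ball /= subr0 ltW// Num.Theory.truncnS_gt.
  apply/negligibleP.
    by apply: bigcupT_measurable => k; exact: measurable_euclid_ball.
  apply: negligible_bigcup => k; apply/negligibleP; last exact: ball0.
  exact: measurable_euclid_ball.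
move=> /(null_set_integral measurableT (@measurable_gauss_rV n)).
rewrite integral_gauss_rV => -[] /eqP.
by rewrite gt_eqF// exprn_gt0// sqrtr_gt0 pi_gt0.
Qed.

Lemma lebesgue_rV_euclid_ball_gt0 n (x : 'rV[R]_n) r : (0 < r)%R ->
  lebesgue_rV R n (euclid_ball x r) = (unit_ball_volume n * r ^+ n)%:E.
Proof.
move=> r0.
by rewrite lebesgue_rV_euclid_ball_scale// unit_ball_volumeE mulrC EFinM.
Qed.

Lemma euclid_ball0 n (x : 'rV[R]_n) : euclid_ball x 0 = [set x].
Proof.
apply/funext => y; rewrite /euclid_ball /=; apply/propext; split => [|->]; last first.
  by rewrite subrr euclid_norm0.
move=> yx; apply/eqP; rewrite -subr_eq0 -euclid_norm_eq0.
by rewrite eq_le yx euclid_norm_ge0.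
Qed.

(** A point lies in balls of arbitrarily small volume; in dimension 0 it has
    measure 1. *)
Lemma lebesgue_rV_set1 n (x : 'rV[R]_n) : (0 < n)%N ->
  lebesgue_rV R n [set x] = 0.
Proof.
move=> n0; apply/eqP; rewrite eq_le measure_ge0 andbT.
apply/lee_addgt0Pr => e e0; rewrite add0e.
have w0 := unit_ball_volume_gt0 n.
pose r := Num.min 1%R (e / unit_ball_volume n)%R.
have r0 : (0 < r)%R by rewrite lt_min ltr01 divr_gt0.
apply: (@le_trans _ _ (lebesgue_rV R n (euclid_ball x r))).
  apply: le_measure; rewrite ?inE.
  - by rewrite -euclid_ball0; exact: measurable_euclid_ball.
  - exact: measurable_euclid_ball.
  - by move=> _ ->; rewrite /euclid_ball /= subrr euclid_norm0 ltW.
rewrite lebesgue_rV_euclid_ball_gt0// lee_fin mulrC -ler_pdivlMr//.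
apply: (@le_trans _ _ r); last by rewrite ge_min lexx orbT.
by rewrite -[leRHS]expr1 ler_wiXn2l// ?ge_min ?lexx// ltW.
Qed.

Lemma lebesgue_rV_euclid_ball n (x : 'rV[R]_n) r : (0 < n)%N -> (0 <= r)%R ->
  lebesgue_rV R n (euclid_ball x r) = (unit_ball_volume n * r ^+ n)%:E.
Proof.
move=> n0; rewrite le_eqVlt => /predU1P[<-|]; last exact: lebesgue_rV_euclid_ball_gt0.
by rewrite expr0n gtn_eqF// mulr0 euclid_ball0 lebesgue_rV_set1.
Qed.

End gauss.

(** * Radial integration *)

Section radial_law.
Context {R : realType}.
Variable (n : nat).
Hypothesis n0 : (0 < n)%N.
Let w : R := unit_ball_volume n.
Let w0 : (0 < w)%R. Proof. exact: unit_ball_volume_gt0. Qed.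
Implicit Types (x y : 'rV[R]_n).

(** The volume of the ball centred at [x] whose sphere passes through [y]. As a
    radial coordinate it is preferable to the distance, since its distribution
    is uniform. *)
Definition ball_content x y : measurableTypeR R :=
  (unit_ball_volume n * euclid_norm (x - y) ^+ n)%R.

Definition content_radius (u : R) : R := ((u / unit_ball_volume n) `^ n%:R^-1)%R.

Lemma content_radius_ge0 u : 0 <= content_radius u.
Proof. exact: powR_ge0. Qed.

Lemma content_radiusX u : 0 <= u -> w * content_radius u ^+ n = u.
Proof.
move=> u0; have uw0 : 0 <= u / w by rewrite divr_ge0// ltW.
rewrite /content_radius -powR_mulrn ?powR_ge0// -powRrM mulVf ?pnatr_eq0 ?gtn_eqF//.
by rewrite powRr1// mulrCA divff ?mulr1// gt_eqF.
Qed.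

Lemma content_radiusK r : 0 <= r -> content_radius (w * r ^+ n) = r.
Proof.
move=> r0; rewrite /content_radius mulrAC divff ?gt_eqF// mul1r.
by rewrite -powR_mulrn// -powRrM divff ?pnatr_eq0 ?gtn_eqF// powRr1.
Qed.

Lemma ball_content_ge0 x y : 0 <= ball_content x y.
Proof. by rewrite mulr_ge0 ?exprn_ge0 ?euclid_norm_ge0// ltW. Qed.

Lemma ball_contentK x y : content_radius (ball_content x y) = euclid_norm (x - y).
Proof. by rewrite content_radiusK// euclid_norm_ge0. Qed.

Lemma ler_ball_content x y r : 0 <= r ->
  (ball_content x y <= w * r ^+ n) = (euclid_norm (x - y) <= r).
Proof.
by move=> r0; rewrite ler_pM2l// ler_pXn2r// ?nnegrE// euclid_norm_ge0.
Qed.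

Lemma ball_content_preimage_le x (v : R) : 0 <= v ->
  ball_content x @^-1` [set u | u <= v] = euclid_ball x (content_radius v).
Proof.
move=> v0; apply/funext => y /=; rewrite euclid_ballE /=.
by rewrite -ler_ball_content ?content_radius_ge0// content_radiusX.
Qed.

Lemma measurable_ball_content x : measurable_fun setT (ball_content x).
Proof.
apply: measurable_funM => //; apply: measurable_funX.
exact: measurable_euclid_dist.
Qed.

Lemma measurable_content_radius :
  measurable_fun setT (content_radius : measurableTypeR R -> measurableTypeR R).
Proof.
apply: (@measurableT_comp _ _ _ _ _ _
  (fun t : measurableTypeR R => t `^ n%:R^-1 : measurableTypeR R)).
  exact: measurable_powR.
by apply: measurable_funM.
Qed.

Local Open Scope ereal_scope.

Lemma lebesgue_rV_content_le x (v : R) : (0 <= v)%R ->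
  lebesgue_rV R n (ball_content x @^-1` [set u | (u <= v)%R]) = v%:E.
Proof.
move=> v0; rewrite ball_content_preimage_le// lebesgue_rV_euclid_ball//.
  by rewrite content_radiusX.
exact: content_radius_ge0.
Qed.

Lemma lebesgue_rV_content_oc x (a b : R) : (0 <= a <= b)%R ->
  lebesgue_rV R n (ball_content x @^-1` `]a, b]%classic) = (b - a)%:E.
Proof.
move=> /andP[a0 ab]; have b0 := le_trans a0 ab.
have -> : ball_content x @^-1` `]a, b]%classic =
    ball_content x @^-1` [set u | (u <= b)%R] `\`
    ball_content x @^-1` [set u | (u <= a)%R].
  apply/seteqP; split => [y /=|y [/= yb /negP]]; rewrite in_itv/=.
    by move=> /andP[ay ->]; split => //; apply/negP; rewrite -ltNge.
  by rewrite -ltNge yb => ->.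
have mle v : (0 <= v)%R -> measurable (ball_content x @^-1` [set u | (u <= v)%R]).
  by move=> v0; rewrite ball_content_preimage_le//; exact: measurable_euclid_ball.
rewrite measureD; [|exact: mle|exact: mle|].
  rewrite setIidr; last by move=> y /= /le_trans; apply.
  by rewrite EFinB; congr (_ - _); exact: lebesgue_rV_content_le.
apply: (@le_lt_trans _ _ b%:E); last exact: ltry.
by rewrite le_eqVlt; apply/predU1P; left; exact: lebesgue_rV_content_le.
Qed.

(** The measure of [ball_content x @^-1` A] and the Lebesgue measure of the
    negative part of [A] add up to a measure that agrees with Lebesgue measure on
    all half-open intervals; adding the negative part makes the uniqueness
    theorem for Lebesgue measure on the whole line applicable. *)
Lemma lebesgue_rV_content x (A : set (measurableTypeR R)) : measurable A ->
  A `<=` `[0%R, +oo[ ->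
  lebesgue_rV R n (ball_content x @^-1` A) = lebesgue_measure A.
Proof.
move=> mA A0.
pose neg : set (measurableTypeR R) := `]-oo, 0%R[%classic.
have mneg : measurable neg by exact: measurable_itv.
have mx := measurable_ball_content x.
pose nu : {measure set (measurableTypeR R) -> \bar R} :=
  measure_add (pushforward (lebesgue_rV R n) (ball_content x))
    (mrestr lebesgue_measure mneg).
have nuE B : nu mx B =
    lebesgue_rV R n (ball_content x @^-1` B) + lebesgue_measure (B `&` neg).
  exact: measure_addE.
have : lebesgue_measure A = nu mx A.
  apply: lebesgue_measure_unique => // _ [[a b]] _ <- /=.
  rewrite nuE.
  have [ba|ab] := leP b a.
    by rewrite set_itv_ge ?bnd_simp -?leNgt// preimage_set0 set0I !measure0 adde0.
  have [b0|b0] := ltP b 0%R.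
    rewrite (_ : _ @^-1` _ = set0); last first.
      apply/seteqP; split => // y /=; rewrite in_itv/= => /andP[_].
      by move=> /le_lt_trans/(_ b0); rewrite ltNge ball_content_ge0.
    rewrite measure0 add0e setIidl// => u /=.
    by rewrite !in_itv/= => /andP[_] /le_lt_trans; apply.
  have [a0|a0] := leP 0%R a.
    rewrite lebesgue_rV_content_oc; last by rewrite a0 ltW.
    rewrite (_ : _ `&` neg = set0) ?measure0 ?adde0.
      by rewrite lebesgue_measure_itv /= lte_fin ab.
    apply/seteqP; split => // u /= []; rewrite !in_itv/= => /andP[au _].
    by move=> /(lt_trans au)/(le_lt_trans a0); rewrite ltxx.
  have -> : ball_content x @^-1` `]a, b]%classic =
      ball_content x @^-1` [set u | (u <= b)%R].
    apply/seteqP; split => y /=; rewrite in_itv/=; first by move=> /andP[].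
    by move=> ->; rewrite (lt_le_trans a0)// ball_content_ge0.
  rewrite lebesgue_rV_content_le//.
  have -> : `]a, b]%classic `&` neg = `]a, 0%R[%classic.
    apply/seteqP; split => u /=; rewrite !in_itv/=; first by move=> [/andP[->]].
    by move=> /andP[-> u0]; split => //; rewrite (le_trans (ltW u0)).
  rewrite !lebesgue_measure_itv /= !lte_fin ab a0.
  by rewrite -!EFinD; congr (_%:E); ring.
rewrite nuE (_ : A `&` neg = set0) ?measure0 ?adde0//.
apply/seteqP; split => // u [/A0] /=.
by rewrite !in_itv/= andbT => u0 /(le_lt_trans u0); rewrite ltxx.
Qed.

Lemma ge0_integral_content x (D : set (measurableTypeR R)) (f : R -> \bar R) :
  measurable D -> D `<=` `[0%R, +oo[ -> measurable_fun D f ->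
  (forall u, D u -> 0 <= f u) ->
  \int[lebesgue_rV R n]_(y in ball_content x @^-1` D) f (ball_content x y) =
  \int[lebesgue_measure]_(u in D) f u.
Proof.
move=> mD D0 mf f0.
have := ge0_integral_pushforward (measurable_ball_content x) (lebesgue_rV R n) mD mf.
move=> <-; last by move=> u; rewrite inE; exact: f0.
apply: eq_measure_integral => [|? A mA AD]; first exact: measurable_ball_content.
by apply: lebesgue_rV_content => //; exact: subset_trans AD D0.
Qed.

Lemma integral_content x (D : set (measurableTypeR R)) (f : R -> \bar R) :
  measurable D -> D `<=` `[0%R, +oo[ -> measurable_fun setT f ->
  (lebesgue_rV R n).-integrable (ball_content x @^-1` D) (f \o ball_content x) ->
  \int[lebesgue_rV R n]_(y in ball_content x @^-1` D) f (ball_content x y) =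
  \int[lebesgue_measure]_(u in D) f u.
Proof.
move=> mD D0 mf fi.
have := integral_pushforward (measurable_ball_content x) mf fi mD.
move=> <-.
apply: eq_measure_integral => [|? A mA AD]; first exact: measurable_ball_content.
by apply: lebesgue_rV_content => //; exact: subset_trans AD D0.
Qed.

End radial_law.

(** * Calculus on the positive half-line *)

Section positive_half_line.
Context {R : realType}.
Implicit Types (f g F G : R -> R) (x a b : R).

Lemma derive1_continuous_pos f F' : (forall x, 0 < x -> is_derive x 1 f (F' x)) ->
  forall x, 0 < x -> {for x, continuous f}.
Proof.
move=> df x x0; apply: differentiable_continuous; apply/derivable1_diffP.
by have [] := df _ x0.
Qed.

Lemma continuous_pos_within f a b : 0 < a ->
  (forall x, 0 < x -> {for x, continuous f}) -> {within `[a, b], continuous f}.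
Proof.
move=> a0 cf; apply: continuous_in_subspaceT => x; rewrite inE/= in_itv/= => /andP[ax _].
exact/cf/(lt_le_trans a0).
Qed.

Lemma continuous_powR_pos (p : R) x : 0 < x ->
  {for x, continuous (@powR R ^~ p)}.
Proof.
move=> x0; apply: differentiable_continuous; apply/derivable1_diffP.
by apply: derivable_powR; rewrite in_itv/= x0.
Qed.

Lemma derivable_LR_pos f F' a b : 0 < a -> a < b ->
  (forall x, 0 < x -> is_derive x 1 f (F' x)) ->
  derivable_oo_LRcontinuous f a b.
Proof.
move=> a0 ab df; split => [x||].
- rewrite in_itv/= => /andP[ax _].
  by have [] := df x (lt_trans a0 ax).
- apply: cvg_at_right_filter.
  exact: (derive1_continuous_pos df).
- apply: cvg_at_left_filter.
  by apply: (derive1_continuous_pos df); exact: lt_trans ab.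
Qed.

Lemma integral_FTC_pos f F a b : 0 < a -> a < b ->
  (forall x, 0 < x -> {for x, continuous f}) ->
  (forall x, 0 < x -> is_derive x 1 F (f x)) ->
  (\int[lebesgue_measure]_(x in `[a, b]) (f x)%:E = (F b - F a)%:E)%E.
Proof.
move=> a0 ab cf dF; rewrite (@continuous_FTC2 _ f F)//.
- exact: continuous_pos_within.
- exact: derivable_LR_pos dF.
- move=> x; rewrite in_itv/= => /andP[ax _].
  by rewrite derive1E; have [_ ->] := dF x (lt_trans a0 ax).
Qed.

Lemma integral_substitution_pos F F' G a b : 0 < a -> a < b ->
  (forall x, 0 < x -> is_derive x 1 F (F' x)) ->
  (forall x, 0 < x -> {for x, continuous F'}) ->
  (forall x y, 0 < x -> x < y -> F x < F y) ->
  (forall x, 0 < x -> 0 < F x) ->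
  (forall x, 0 < x -> {for x, continuous G}) ->
  (\int[lebesgue_measure]_(u in `[F a, F b]) (G u)%:E =
   \int[lebesgue_measure]_(t in `[a, b]) (G (F t) * F' t)%:E)%E.
Proof.
move=> a0 ab dF cF' mF F0 cG.
have F'E x : 0 < x -> (F^`())%classic x = F' x.
  by move=> x0; rewrite derive1E; have [_ ->] := dF x x0.
have cdF x : 0 < x -> {for x, continuous (F^`())%classic}.
  move=> x0; rewrite /prop_for /continuous_at F'E//; apply: cvg_trans (cF' x x0).
  apply: near_eq_cvg; near=> t; apply/esym/F'E.
  by near: t; exact: lt_nbhsr.
rewrite (@integration_by_substitution_increasing _ F G)//; last 7 first.
- exact: ltW.
- move=> x y; rewrite !in_itv/= => /andP[ax _] _; apply: mF.
  exact: lt_le_trans ax.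
- by move=> x; rewrite in_itv/= => /andP[ax _]; exact/cdF/(lt_trans a0).
- by apply/cvg_ex; exists ((F^`())%classic a); apply: cvg_at_right_filter; exact: cdF.
- apply/cvg_ex; exists ((F^`())%classic b); apply: cvg_at_left_filter.
  exact/cdF/(lt_trans a0).
- exact: derivable_LR_pos dF.
- by apply: continuous_pos_within => //; exact: F0.
apply: eq_integral => t; rewrite inE/= in_itv/= => /andP[at_ _].
rewrite -(F'E t)//; exact: lt_le_trans at_.
Unshelve. all: by end_near. Qed.

(** Integrals over the open half-line are limits over compact intervals away
    from 0, where power functions of any exponent are smooth. *)
Lemma cvg_integral_pos (f : R -> \bar R) (a b : R^nat) :
  {homo a : m n / (m <= n)%N >-> n <= m} -> {homo b : m n / (m <= n)%N >-> m <= n} ->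
  (forall k, 0 < a k) ->
  (forall x, 0 < x -> exists k, a k <= x <= b k) ->
  measurable_fun (`]0%R, +oo[%classic : set (measurableTypeR R)) f ->
  (forall x, 0 < x -> (0 <= f x)%E) ->
  (\int[lebesgue_measure]_(x in `[a k, b k]) f x)%E @[k --> \oo] -->
  (\int[lebesgue_measure]_(x in `]0%R, +oo[) f x)%E.
Proof.
move=> na nb a0 ab mf f0.
have sub k : `[a k, b k]%classic `<=` `]0, +oo[.
  by move=> x /=; rewrite !in_itv/= andbT => /andP[/(lt_le_trans (a0 k))].
rewrite (_ : `]0, +oo[%classic = \bigcup_k `[a k, b k]%classic); last first.
  apply/seteqP; split => [x/=|x [k _]]; last exact: sub.
  by rewrite in_itv/= andbT => /ab[k]; exists k => //=; rewrite in_itv.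
apply: ge0_nondecreasing_set_cvg_integral => //.
- move=> m n mn; apply/subsetPset => x /=; rewrite !in_itv/= => /andP[ax xb].
  by rewrite (le_trans (na _ _ mn))// (le_trans xb)// nb.
- by move=> k; apply: measurable_funS mf => //; exact: sub.
- by move=> k x /sub /=; rewrite in_itv/= andbT; exact: f0.
Qed.

End positive_half_line.

(** * The area of the unit sphere *)

Section sphere_area.
Context {R : realType}.
Variable n : nat.
Hypothesis n0 : (0 < n)%N.
Let w : R := unit_ball_volume n.
Let w0 : 0 < w. Proof. exact: unit_ball_volume_gt0. Qed.
Let p : R := n%:R / 2.
Let p0 : 0 < p. Proof. by rewrite divr_gt0// ltr0n. Qed.

Lemma content_radius_sqr t : 0 <= t -> content_radius n (w * t `^ p) ^+ 2 = t.
Proof.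
move=> t0; rewrite /content_radius mulrAC divff ?gt_eqF// mul1r.
rewrite -powR_mulrn ?powR_ge0// -!powRrM.
rewrite (_ : p * (_ * _) = 1) ?powRr1//.
by rewrite /p; field; rewrite pnatr_eq0 gtn_eqF.
Qed.

Lemma continuous_content_radius u : 0 < u ->
  {for u, continuous (content_radius n : R -> R)}.
Proof.
move=> u0; rewrite -[content_radius n]/((@powR R ^~ n%:R^-1) \o (fun u => u / w)).
apply: continuous_comp; first exact: mulrr_continuous.
by apply: continuous_powR_pos; rewrite divr_gt0.
Qed.

(** The radial evaluation of the Gaussian integral: in the content coordinate
    [u] it becomes a Gamma integral under the substitution [u = w t^(n/2)], as
    [t] is then the squared radius. *)
Lemma gauss_Gamma :
  ((Num.sqrt pi ^+ n)%:E = (w * p)%:E *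
  \int[lebesgue_measure]_(t in `]0%R, +oo[) (t `^ (p - 1) * expR (- t))%:E)%E.
Proof.
pose G (u : R) := gauss_fun (content_radius n u).
have cG (u : R) : 0 < u -> {for u, continuous G}.
  move=> u0; apply: continuous_comp; first exact: continuous_content_radius.
  exact: continuous_gauss_fun.
have mG : measurable_fun setT (fun u => (G u)%:E).
  apply/measurable_EFinP/measurableT_comp; first exact: measurable_gauss_fun.
  exact: measurable_content_radius.
have -> : ((Num.sqrt pi ^+ n)%:E = \int[lebesgue_measure]_(u in `]0%R, +oo[) (G u)%:E)%E.
  rewrite integral_itv_obnd_cbnd; last exact: measurable_funS mG.
  rewrite -(@ge0_integral_content _ _ n0 0)//; last 2 first.
  - exact: measurable_funS mG.
  - by move=> u _; rewrite lee_fin gauss_fun_ge0.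
  rewrite (_ : _ @^-1` _ = setT); last first.
    apply/seteqP; split => // y _ /=; rewrite in_itv/= andbT.
    exact: ball_content_ge0.
  rewrite -integral_gauss_rV; apply: eq_integral => y _.
  by rewrite /G ball_contentK// sub0r euclid_normN.
pose F (t : R) := w * t `^ p.
pose F' (t : R) := w * (p * t `^ (p - 1)).
have dF (x : R) : 0 < x -> is_derive x 1 F (F' x).
  by move=> x0; apply: (@is_deriveZ _ _ _ (@powR R ^~ p)); exact: is_derive1_powR.
have cF' (x : R) : 0 < x -> {for x, continuous F'}.
  move=> x0; apply: (@continuous_comp _ _ _ (fun t => p * t `^ (p - 1)) (fun t => w * t)).
    apply: (@continuous_comp _ _ _ (fun t => t `^ (p - 1)) (fun t => p * t)).
      exact: continuous_powR_pos.
    exact: mulrl_continuous.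
  exact: mulrl_continuous.
have F0 (x : R) : 0 < x -> 0 < F x by move=> x0; rewrite mulr_gt0// powR_gt0.
have mF (x y : R) : 0 < x -> x < y -> F x < F y.
  move=> x0 xy; rewrite ltr_pM2l// gt0_ltr_powR// nnegrE ltW//.
  exact: lt_trans xy.
have mF' (x y : R) : 0 < x -> x <= y -> F x <= F y.
  by move=> x0; rewrite le_eqVlt => /predU1P[->//|xy]; exact/ltW/mF.
pose a k : R := k.+2%:R^-1; pose b k : R := k.+2%:R.
have a0 k : 0 < a k by rewrite invr_gt0.
have ab k : a k < b k.
  by apply: (@lt_trans _ _ 1); rewrite ?invf_lt1// ltr1n.
have na : {homo a : m n / (m <= n)%N >-> n <= m}.
  by move=> i j ij; rewrite lef_pV2 ?posrE// ler_nat.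
have nb : {homo b : m n / (m <= n)%N >-> m <= n}.
  by move=> i j ij; rewrite ler_nat.
have exh (x : R) : 0 < x -> exists k, a k <= x <= b k.
  move=> x0; exists (Num.truncn (Num.max x x^-1)).
  have h : Num.max x x^-1 <= b (Num.truncn (Num.max x x^-1)).
    by rewrite (le_trans (ltW (Num.Theory.truncnS_gt _)))// ler_nat.
  move: h; rewrite ge_max => /andP[-> h]; rewrite andbT.
  by rewrite /a invf_ple ?posrE.
(* Both sides are exhausted by corresponding intervals, [F (a k), F (b k)] and
   [a k, b k]; the substitution is performed on each of them. *)
have := @cvg_integral_pos R (fun u => (G u)%:E) (F \o a) (F \o b).
move=> /(_ _ _ _ _ _ _)/cvg_lim <-//; last 6 first.
- by move=> i j ij; apply: mF' => //; exact: na.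
- by move=> i j ij; apply: mF'; [rewrite ltr0n|exact: nb].
- by move=> k; exact: F0.
- move=> u u0; have uw0 : 0 < (u / w) `^ p^-1 by rewrite powR_gt0// divr_gt0.
  have Fu : F ((u / w) `^ p^-1) = u.
    rewrite /F -powRrM mulVf ?gt_eqF// powRr1; last by rewrite divr_ge0// ltW.
    by rewrite mulrCA divff ?mulr1// gt_eqF.
  have [k /andP[ak bk]] := exh _ uw0; exists k.
  by rewrite -{1 2}Fu /= !mF'.
- exact: measurable_funS mG.
- by move=> x _; rewrite lee_fin gauss_fun_ge0.
pose H (t : R) := (t `^ (p - 1) * expR (- t))%:E.
have mH : measurable_fun setT H.
  apply/measurable_EFinP/measurable_funM; first exact: measurable_powR.
  by apply: measurableT_comp => //; exact: measurableT_comp.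
have H0 t : (0 <= H t)%E by rewrite lee_fin mulr_ge0 ?powR_ge0 ?expR_ge0.
have wp0 : 0 <= w * p by rewrite mulr_ge0 ?ltW.
rewrite -ge0_integralZl//; [|exact: measurable_funS mH|by move=> t _; exact: H0].
have := @cvg_integral_pos R (fun t => (w * p)%:E * H t)%E a b na nb a0 exh.
move=> /(_ _ _)/cvg_lim <-//; last 2 first.
- by apply: measurable_funeM; exact: measurable_funS mH.
- by move=> x _; rewrite mule_ge0// lee_fin.
congr (limn _); apply/funext => k /=.
rewrite (integral_substitution_pos (a0 k) (ab k) dF cF' mF F0 cG).
apply: eq_integral => t; rewrite inE/= in_itv/= => /andP[/(lt_le_trans (a0 k)) t0 _].
rewrite /G /gauss_fun content_radius_sqr ?ltW// -EFinM; congr (_%:E).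
by rewrite /F'; ring.
Qed.

Lemma sphere_areaE : sphere_area n = n%:R * w.
Proof.
have /(congr1 fine) := gauss_Gamma.
have pi0 : 0 < Num.sqrt pi ^+ n :> R by rewrite exprn_gt0// sqrtr_gt0 pi_gt0.
have wp0 : 0 < w * p by rewrite mulr_gt0.
rewrite fineM//; last first.
  have := gauss_Gamma; case: (integral _ _ _) => // => [|] /eqP.
    by rewrite gt0_muley.
  by rewrite gt0_muleNy.
rewrite /= -/(Rintegral _ _ _) -/(Gamma p) => E.
have G0 : Gamma p != 0 by apply/eqP => G0; move: pi0; rewrite E G0 mulr0 ltxx.
rewrite /sphere_area -/p (_ : pi `^ p = Num.sqrt pi ^+ n).
  by rewrite E /p; field.
rewrite -powR12_sqrt ?pi_ge0// -powR_mulrn ?powR_ge0// -powRrM; congr (_ `^ _).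
by rewrite /p mulrC.
Qed.

End sphere_area.

(** * The kernel and its integrals over shells and balls *)

Section kernel.
Context {R : realType}.
Variable n : nat.
Implicit Types (alpha s t : R).

(** The kernel of the potential, with its sign reversed when the extreme value
    is a minimum, so that it decreases on positive distances for every [alpha]. *)
Definition riesz_kernel alpha s : R :=
  if n%:R < alpha then - (s `^ (alpha - n%:R))
  else if alpha == n%:R then - ln s
  else s `^ (alpha - n%:R).

Lemma riesz_kernel_decr alpha s t : 0 < s -> s < t ->
  riesz_kernel alpha t < riesz_kernel alpha s.
Proof.
move=> s0 st; have t0 := lt_trans s0 st.
rewrite /riesz_kernel; have [na|an|_] := ltgtP n%:R alpha.
- by rewrite ltrN2 gt0_ltr_powR ?subr_gt0// nnegrE ltW.
- rewrite -(opprB n%:R) !powRN ltf_pV2 ?posrE ?powR_gt0//.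
  by rewrite gt0_ltr_powR ?subr_gt0// nnegrE ltW.
- by rewrite ltrN2 ltr_ln.
Qed.

Lemma riesz_kernel_nincr alpha s t : 0 < s -> s <= t ->
  riesz_kernel alpha t <= riesz_kernel alpha s.
Proof.
by move=> s0; rewrite le_eqVlt => /predU1P[->//|st]; exact/ltW/riesz_kernel_decr.
Qed.

Lemma measurable_riesz_kernel alpha :
  measurable_fun setT (riesz_kernel alpha : measurableTypeR R -> measurableTypeR R).
Proof.
rewrite /riesz_kernel; have [_|_|_] := ltgtP n%:R alpha.
- by apply: measurableT_comp => //; exact: measurable_powR.
- exact: measurable_powR.
- by apply: measurableT_comp => //; exact: measurable_ln.
Qed.

End kernel.

Section annulus.
Context {R : realType}.
Variable n : nat.
Hypothesis n0 : (0 < n)%N.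
Let w : R := unit_ball_volume n.
Let w0 : 0 < w. Proof. exact: unit_ball_volume_gt0. Qed.
Implicit Types (x y : 'rV[R]_n) (alpha r e : R).

Lemma measurable_kernel_dist (k : R -> R) x :
  measurable_fun setT (k : measurableTypeR R -> measurableTypeR R) ->
  measurable_fun setT (fun y => k (euclid_norm (x - y))).
Proof.
move=> mk; apply: (@measurableT_comp _ _ _ _ _ _
  (k : measurableTypeR R -> measurableTypeR R)) => //.
exact: measurable_euclid_dist.
Qed.

(** The integral of [s ^ (alpha - 1)] from [e] to [r], times the area of the
    unit sphere. *)
Definition annulus_energy alpha e r : R :=
  if alpha == 0 then sphere_area n * (ln r - ln e)
  else sphere_area n / alpha * (r `^ alpha - e `^ alpha).

(** In the content coordinate [u] the integrand is a multiple of
    [u ^ (alpha / n - 1)], which has an elementary primitive. *)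
Lemma integral_annulus alpha x e r : 0 < e -> e < r ->
  (\int[lebesgue_rV R n]_(y in euclid_ball x r `\` euclid_ball x e)
    (euclid_norm (x - y) `^ (alpha - n%:R))%:E = (annulus_energy alpha e r)%:E)%E.
Proof.
move=> e0 er; have r0 := lt_trans e0 er.
pose f u := content_radius n u `^ (alpha - n%:R).
have we0 : 0 < w * e ^+ n by rewrite mulr_gt0// exprn_gt0.
have wer : w * e ^+ n < w * r ^+ n.
  by rewrite ltr_pM2l// ltrXn2r ?ltW// ?nnegrE ?ltW// gtn_eqF.
have cf u : 0 < u -> {for u, continuous f}.
  move=> u0; rewrite -[f]/((@powR R ^~ (alpha - n%:R)) \o content_radius n).
  apply: continuous_comp; first exact: continuous_content_radius.
  by apply: continuous_powR_pos; rewrite powR_gt0// divr_gt0.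
have mf : measurable_fun setT (fun u : measurableTypeR R => (f u)%:E).
  apply/measurable_EFinP.
  apply: (@measurableT_comp _ _ _ _ _ _ (@powR R ^~ (alpha - n%:R))).
    exact: measurable_powR.
  exact: measurable_content_radius.
have -> : euclid_ball x r `\` euclid_ball x e =
    ball_content x @^-1` `](w * e ^+ n)%R, (w * r ^+ n)%R]%classic.
  rewrite !euclid_ballE; apply/seteqP; split => y /=; rewrite in_itv/= ltNge.
    move=> [yr /negP ye].
    by rewrite (ler_ball_content n0 _ _ (ltW e0)) (ler_ball_content n0 _ _ (ltW r0)) yr ye.
  rewrite (ler_ball_content n0 _ _ (ltW e0)) (ler_ball_content n0 _ _ (ltW r0)).
  by move=> /andP[/negP].
transitivity (\int[lebesgue_measure]_(u in `](w * e ^+ n)%R, (w * r ^+ n)%R]) (f u)%:E)%E.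
  have /= <- := @ge0_integral_content R n n0 x
    (`](w * e ^+ n)%R, (w * r ^+ n)%R]%classic) (fun u => (f u)%:E).
  - by apply: eq_integral => y _; rewrite /f ball_contentK.
  - exact: measurable_itv.
  - by move=> u /=; rewrite !in_itv/= andbT => /andP[/(lt_trans we0)/ltW].
  - exact: measurable_funS mf.
  - by move=> u _; rewrite lee_fin powR_ge0.
rewrite integral_itv_obnd_cbnd; last exact: measurable_funS mf.
have nR0 : n%:R != 0 :> R by rewrite pnatr_eq0 gtn_eqF.
have fE (u : R) : 0 < u -> f u = w `^ (1 - alpha / n%:R) * u `^ (alpha / n%:R - 1).
  move=> u0; rewrite /f /content_radius -powRrM powRM ?invr_ge0 ?ltW// mulrC.
  rewrite -[X in X `^ _]powR_inv1 ?ltW// -powRrM; congr (_ `^ _ * _ `^ _).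
    by field.
  by field.
have content_powR (s b : R) : 0 < s ->
    w `^ (- (b / n%:R)) * (w * s ^+ n) `^ (b / n%:R) = s `^ b.
  move=> s0; rewrite powRM ?ltW ?exprn_gt0// mulrA powRN mulVf ?mul1r; last first.
    by rewrite gt_eqF// powR_gt0.
  by rewrite -powR_mulrn ?ltW// -powRrM; congr (_ `^ _); field.
rewrite /annulus_energy sphere_areaE// -/w; case: eqP => [a0|/eqP a0].
- have dP (u : R) : 0 < u -> is_derive u 1 (fun u => w * ln u) (f u).
    move=> u0; rewrite (fE _ u0) a0 mul0r subr0 sub0r.
    rewrite (powR_inv1 (ltW u0)) (powRr1 (ltW w0)).
    by apply: (@is_deriveZ _ _ _ (@ln R)); exact: is_derive1_ln.
  rewrite (integral_FTC_pos we0 wer cf dP).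
  rewrite !lnM ?posrE ?exprn_gt0// !lnXn// -[ln e *+ n]mulr_natr -[ln r *+ n]mulr_natr.
  by congr (_%:E); ring.
- pose C := w * n%:R / alpha * w `^ (- (alpha / n%:R)).
  have wE : w `^ (1 - alpha / n%:R) = w * w `^ (- (alpha / n%:R)).
    by rewrite powRD ?powRr1 ?(ltW w0)// (gt_eqF w0) implybT.
  have dP (u : R) : 0 < u -> is_derive u 1 (fun u => C * u `^ (alpha / n%:R)) (f u).
    move=> u0; rewrite (fE _ u0).
    rewrite (_ : w `^ _ * _ = C * (alpha / n%:R * u `^ (alpha / n%:R - 1))); last first.
      rewrite wE /C.
      by field; rewrite a0 nR0.
    by apply: (@is_deriveZ _ _ _ (@powR R ^~ _)); exact: is_derive1_powR.
  rewrite (integral_FTC_pos we0 wer cf dP).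
  rewrite -(content_powR r)// -(content_powR e)// /= /C.
  by congr (_%:E); field.
Qed.

(** The integrals over the shells with inner radius [1 / (k + 1)] increase to
    the integral over the punctured ball, and [annulus_energy] bounds them
    uniformly since the exponent [alpha] is positive. *)
Lemma ge0_ball_energy_ltey alpha x r : 0 < alpha -> 0 < r ->
  (\int[lebesgue_rV R n]_(y in euclid_ball x r `\ x)
    (euclid_norm (x - y) `^ (alpha - n%:R))%:E < +oo)%E.
Proof.
move=> a0 r0.
pose F k := euclid_ball x r `\` euclid_ball x (k.+1%:R^-1).
have F_cover : euclid_ball x r `\ x = \bigcup_k F k.
  apply/seteqP; split => [y [yr yx]|y [k _ [yr yk]]]; last first.
    split => // yx; apply: yk; rewrite yx /euclid_ball /= subrr euclid_norm0.
    by rewrite invr_ge0.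
  have d0 : 0 < euclid_norm (y - x).
    rewrite lt_neqAle euclid_norm_ge0 andbT eq_sym euclid_norm_eq0 subr_eq0.
    exact/eqP.
  have /ltr_add_invr[k] := d0; rewrite add0r => kd.
  by exists k => //; split => //; rewrite /euclid_ball /=; apply/negP; rewrite -ltNge.
have mF k : measurable (F k).
  by apply: measurableD; exact: measurable_euclid_ball.
have mf : measurable_fun setT (fun y => (euclid_norm (x - y) `^ (alpha - n%:R))%:E).
  apply/measurable_EFinP; apply: (measurable_kernel_dist (k := @powR R ^~ _)).
  exact: measurable_powR.
have f0 y : (0 <= (euclid_norm (x - y) `^ (alpha - n%:R))%:E)%E by rewrite lee_fin powR_ge0.
have ndF : nondecreasing_seq F.
  move=> i j ij; apply/subsetPset => y [yr yi]; split => // yj; apply: yi.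
  by rewrite /euclid_ball /= (le_trans yj)// lef_pV2 ?posrE// ler_nat.
have := @ge0_nondecreasing_set_cvg_integral _ _ _ F _ (lebesgue_rV R n) ndF mF
  (fun i => measurable_funS measurableT (@subsetT _ _) mf) (fun _ _ _ => f0 _).
rewrite -F_cover => cvgF.
apply: (@le_lt_trans _ _ (sphere_area n / alpha * r `^ alpha)%:E); last exact: ltry.
rewrite -(cvg_lim _ cvgF)//; apply: lime_le; first by apply/cvg_ex; eexists; exact: cvgF.
near=> k.
have kr : k.+1%:R^-1 < r.
  near: k; have /ltr_add_invr[k] := r0; rewrite add0r => kr.
  exists k => // j /= kj; rewrite (le_lt_trans _ kr)// lef_pV2 ?posrE// ler_nat.
  by rewrite ltnS.
rewrite integral_annulus ?invr_gt0// lee_fin /annulus_energy gt_eqF//.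
rewrite ler_wpM2l//; first by rewrite sphere_areaE// divr_ge0 ?ltW// mulr_gt0// ltr0n.
by rewrite lerBlDr lerDl powR_ge0.
Unshelve. all: by end_near. Qed.

Lemma integrable_powR_dist alpha x r : 0 < alpha -> 0 < r ->
  (lebesgue_rV R n).-integrable (euclid_ball x r)
    (EFin \o (fun y => euclid_norm (x - y) `^ (alpha - n%:R))).
Proof.
move=> a0 r0.
have mf : measurable_fun setT (EFin \o (fun y => (euclid_norm (x - y) `^ (alpha - n%:R)))).
  apply/measurable_EFinP; apply: (measurable_kernel_dist (k := @powR R ^~ _)).
  exact: measurable_powR.
have mB := measurable_euclid_ball x r.
have m1 : measurable [set x] by rewrite -euclid_ball0; exact: measurable_euclid_ball.
apply/(@negligible_integrable _ _ _ (lebesgue_rV R n) _ _ _ m1 mB).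
- exact: measurable_funS mf.
- exact: lebesgue_rV_set1.
apply/integrableP; split; first by apply: measurable_funS mf => //; exact: measurableD.
under eq_integral do rewrite /= ger0_norm ?powR_ge0//.
exact: ge0_ball_energy_ltey.
Qed.

End annulus.

Section integrability.
Context {R : realType}.
Variable n : nat.
Hypothesis n1 : (1 < n)%N.
Let n0 : (0 < n)%N. Proof. exact: ltnW. Qed.
Let nR0 : 0 < n%:R :> R. Proof. by rewrite ltr0n. Qed.
Implicit Types (x y : 'rV[R]_n) (A : set 'rV[R]_n) (alpha r e : R).
Notation mu := (lebesgue_rV R n).

Definition pair_energy alpha x y : R := riesz_kernel n alpha (euclid_norm (x - y)).

Lemma measurable_pair_energy alpha x : measurable_fun setT (pair_energy alpha x).
Proof.
apply: (measurable_kernel_dist (k := riesz_kernel n alpha)).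
exact: measurable_riesz_kernel.
Qed.

Lemma lebesgue_rV_euclid_ball_lty x r : (mu (euclid_ball x r) < +oo)%E.
Proof.
apply: (@le_lt_trans _ _ (mu (euclid_ball x (Num.max r 1)))).
  apply: le_measure; rewrite ?inE; try exact: measurable_euclid_ball.
  by move=> y; rewrite /euclid_ball /= => /le_trans; apply; rewrite le_max lexx.
by rewrite lebesgue_rV_euclid_ball ?ltry// le_max ler01 orbT.
Qed.

Lemma integrable_bounded_rV A x r (f : 'rV[R]_n -> R) M :
  measurable A -> A `<=` euclid_ball x r -> measurable_fun setT f ->
  (forall y, A y -> `|f y| <= M) -> mu.-integrable A (EFin \o f).
Proof.
move=> mA Ar mf fM; apply: measurable_bounded_integrable => //.
- apply: le_lt_trans (lebesgue_rV_euclid_ball_lty x r).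
  by apply: le_measure; rewrite ?inE//; exact: measurable_euclid_ball.
- exact: measurable_funS mf.
- exists M; split; first exact: num_real.
  by move=> N MN y Ay; apply: le_trans (fM _ Ay) _; exact: ltW.
Qed.

(** Away from [x] the kernel is bounded, being monotone, so every [alpha] is
    allowed. *)
Lemma integrable_pair_energy_away alpha x A r e : 0 < e ->
  measurable A -> A `<=` euclid_ball x r `\` euclid_ball x e ->
  mu.-integrable A (EFin \o pair_energy alpha x).
Proof.
move=> e0 mA Are; pose k := riesz_kernel n alpha.
apply: (@integrable_bounded_rV _ x r _ (`|k r| + `|k e|)) => //.
- by move=> y /Are[].
- exact: measurable_pair_energy.
move=> y /Are[]; rewrite !euclid_ballE /= => yr /negP; rewrite -ltNge => ey.
have y0 := lt_trans e0 ey.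
rewrite ler_norml; apply/andP; split.
  apply: (@le_trans _ _ (k r)); last exact: riesz_kernel_nincr.
  by rewrite opprD lerBlDr (le_trans (lerNnormlW (lexx _)))// lerDl.
apply: (@le_trans _ _ (k e)); first by apply: riesz_kernel_nincr; rewrite // ltW.
by rewrite (le_trans (ler_norm _))// lerDr.
Qed.

(** For [alpha > n] the kernel is bounded; for [0 < alpha < n] this is the
    bound on shells; the logarithm is dominated by [1 / s + r], whose first term
    is the kernel of exponent [n - 1], positive since the dimension is at least
    2. *)
Lemma integrable_pair_energy_ball alpha x r : 0 < alpha -> 0 < r ->
  mu.-integrable (euclid_ball x r) (EFin \o pair_energy alpha x).
Proof.
move=> a0 r0; have mB := measurable_euclid_ball x r.
have mp := measurable_pair_energy alpha x.
have [na|an|an] := ltgtP n%:R alpha.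
- apply: (@integrable_bounded_rV _ x r _ (r `^ (alpha - n%:R))) => //.
  rewrite euclid_ballE => y /= yr; rewrite /pair_energy /riesz_kernel na normrN.
  rewrite ger0_norm ?powR_ge0//; apply: ge0_ler_powR => //.
  - by rewrite subr_ge0 ltW.
  - by rewrite nnegrE euclid_norm_ge0.
  - by rewrite nnegrE ltW.
- rewrite (_ : pair_energy alpha x = fun y => euclid_norm (x - y) `^ (alpha - n%:R)).
    exact: integrable_powR_dist.
  apply/funext => y; rewrite /pair_energy /riesz_kernel ltNge ltW//=.
  by rewrite lt_eqF.
- pose g1 y := euclid_norm (x - y) `^ (n%:R - 1 - n%:R).
  have ig1 : mu.-integrable (euclid_ball x r) (EFin \o g1).
    by apply: integrable_powR_dist => //; rewrite subr_gt0 ltr1n.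
  have ir : mu.-integrable (euclid_ball x r) (EFin \o (fun=> r)).
    by apply: (@integrable_bounded_rV _ x r _ `|r|).
  apply: (le_integrable mB _ _ (integrableD mB ig1 ir)).
    by apply/measurable_EFinP; exact: measurable_funS mp.
  rewrite euclid_ballE => y /= yr; rewrite lee_fin /pair_energy /riesz_kernel.
  rewrite -an ltxx eqxx normrN /g1 addrAC subrr add0r powR_inv1 ?euclid_norm_ge0//.
  set s := euclid_norm _ in yr *.
  have := euclid_norm_ge0 (x - y); rewrite -/s le_eqVlt => /predU1P[<-|s0].
    by rewrite ln0// normr0.
  have sV0 : 0 < s^-1 by rewrite invr_gt0.
  rewrite [leRHS]ger0_norm; last by rewrite addr_ge0 ?ltW.
  rewrite ler_norml; apply/andP; split.
    rewrite lerNl -lnV ?posrE// ltW// (lt_le_trans (ln_sublinear sV0))//.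
    by rewrite lerDl ltW.
  by rewrite ltW// (lt_le_trans (ln_sublinear s0))// (le_trans yr)// lerDr ltW.
Qed.

End integrability.

(** * Comparison with the ball of the same volume *)

Section comparison.
Context {R : realType}.
Variable n : nat.
Hypothesis n1 : (1 < n)%N.
Let n0 : (0 < n)%N. Proof. exact: ltnW. Qed.
Implicit Types (x y : 'rV[R]_n) (A Omega N : set 'rV[R]_n) (alpha r e : R).
Notation mu := (lebesgue_rV R n).

(** What is lost at [x] when the ball is deformed into Omega: the energy of the
    points given up minus the energy of the points gained. *)
Definition energy_deficit alpha Omega x r : R :=
  \int[mu]_(y in euclid_ball x r `\` Omega) pair_energy alpha x y -
  \int[mu]_(y in Omega `\` euclid_ball x r) pair_energy alpha x y.

Lemma measure_setD_eq A B : measurable A -> measurable B ->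
  (mu A < +oo)%E -> mu A = mu B -> mu (A `\` B) = mu (B `\` A).
Proof.
move=> mA mB Aoo AB; have Boo : (mu B < +oo)%E by rewrite -AB.
rewrite !measureD//; congr (_ - _)%E; first exact: AB.
by congr (mu _); exact: setIC.
Qed.

(** The exchanged sets have equal volume, and the value of the kernel on the
    sphere of radius [r] separates its values on them. This value is a strict
    bound outside the ball, so that equality forces the outer set, hence both,
    to be null. *)
Lemma energy_deficit_ge0 alpha Omega x r : 0 < r ->
  measurable Omega -> mu Omega = mu (euclid_ball x r) ->
  mu.-integrable (Omega `\` euclid_ball x r) (EFin \o pair_energy alpha x) ->
  mu.-integrable (euclid_ball x r `\` Omega) (EFin \o pair_energy alpha x) ->
  0 <= energy_deficit alpha Omega x r /\
  (energy_deficit alpha Omega x r = 0 ->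
    mu (Omega `\` euclid_ball x r) = 0%E /\ mu (euclid_ball x r `\` Omega) = 0%E).
Proof.
move=> r0 mO vol; set P := Omega `\` _; set Q := _ `\` Omega => iP iQ.
have mB := measurable_euclid_ball x r.
have mP : measurable P by exact: measurableD.
have mQ : measurable Q by exact: measurableD.
have m1 : measurable [set x] by rewrite -euclid_ball0; exact: measurable_euclid_ball.
have Boo := lebesgue_rV_euclid_ball_lty n1 x r.
have PQ : mu P = mu Q by apply: measure_setD_eq => //; rewrite vol.
have Qoo : (mu Q < +oo)%E.
  by apply: le_lt_trans Boo; apply: le_measure; rewrite ?inE//; exact: subDsetl.
have Poo : (mu P < +oo)%E by rewrite PQ.
pose k := riesz_kernel n alpha.
have icst D (c : R) : measurable D -> (mu D < +oo)%E -> mu.-integrable D (EFin \o (fun=> c)).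
  move=> mD Doo; apply: measurable_bounded_integrable => //.
  exists `|c|; split; first exact: num_real.
  by move=> M cM y _ /=; exact: ltW.
(* The point [x] is removed first: the kernel takes a default value at
   distance 0, which breaks monotonicity there. *)
have hQ : k r * fine (mu Q) <= \int[mu]_(y in Q) pair_energy alpha x y.
  pose Q' := Q `\` [set x].
  have mQ' : measurable Q' by exact: measurableD.
  have Q'Q : Q' `<=` Q by exact: subDsetl.
  have x0 : mu [set x] = 0%E by exact: lebesgue_rV_set1.
  rewrite /Rintegral (negligible_integral m1 mQ iQ x0) -/Q' -/(Rintegral mu Q' _).
  have -> : mu Q = mu Q'.
    have QI0 : mu (Q `&` [set x]) = 0%E.
      apply: (subset_measure0 (measurableI _ _ mQ m1) m1 _ x0).
      exact: subIsetr.
    transitivity (mu Q - mu (Q `&` [set x]))%E; first by rewrite QI0 sube0.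
    by apply/esym; exact: measureD.
  have Q'oo : (mu Q' < +oo)%E.
    by apply: le_lt_trans Qoo; apply: le_measure; rewrite ?inE.
  have iQ' : mu.-integrable Q' (EFin \o pair_energy alpha x).
    exact: integrableS iQ.
  rewrite -(Rintegral_cst mu mQ' (k r)).
  apply: (le_Rintegral mQ' (icst _ _ mQ' Q'oo) iQ').
  move=> y [[+ _] yx]; rewrite euclid_ballE /= => yr.
  apply: riesz_kernel_nincr => //.
  rewrite lt_neqAle euclid_norm_ge0 andbT eq_sym euclid_norm_eq0 subr_eq0 eq_sym.
  by apply/eqP.
have ltP y : P y -> pair_energy alpha x y < k r.
  move=> [_]; rewrite euclid_ballE /= => /negP; rewrite -ltNge => ry.
  exact: riesz_kernel_decr.
have hP : \int[mu]_(y in P) pair_energy alpha x y <= k r * fine (mu P).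
  rewrite -(Rintegral_cst mu mP (k r)).
  by apply: (le_Rintegral mP iP (icst _ _ mP Poo)) => y /ltP/ltW.
rewrite /energy_deficit -/P -/Q; split.
  by rewrite subr_ge0 (le_trans hP)// PQ.
move/eqP; rewrite subr_eq0 => /eqP E.
have {hQ} EP : \int[mu]_(y in P) pair_energy alpha x y = k r * fine (mu P).
  by apply/eqP; rewrite eq_le hP PQ -E hQ.
suff P0 : mu P = 0%E by rewrite -PQ.
have ikr := icst P (k r) mP Poo.
have : \int[mu]_(y in P) (k r - pair_energy alpha x y) = 0.
  by rewrite RintegralB// Rintegral_cst// EP subrr.
have mf : measurable_fun P (fun y => (k r - pair_energy alpha x y)%:E).
  apply/measurable_EFinP; apply: measurable_funB => //.
  exact: measurable_funS (measurable_pair_energy alpha x).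
have id : mu.-integrable P (fun y => (k r - pair_energy alpha x y)%:E).
  exact: (integrableB mP ikr iP).
move=> I0; have {}I0 : (\int[mu]_(y in P) (k r - pair_energy alpha x y)%:E = 0)%E.
  by rewrite -[LHS]fineK ?integrable_fin_num//; congr (_%:E).
have : (\int[mu]_(y in P) `|(k r - pair_energy alpha x y)%:E| = 0)%E.
  rewrite -[RHS]I0; apply: eq_integral => y; rewrite inE => /ltP Py.
  by rewrite gee0_abs// lee_fin subr_ge0 ltW.
move=> /(ae_eq_integral_abs mu mP mf)[Z [mZ Z0 PZ]].
apply: (subset_measure0 mP mZ _ Z0).
move=> y Py; apply: PZ => /= h; have /eqP := h Py.
by rewrite eqe subr_eq0 gt_eqF// ltP.
Qed.

(** The common part [N] may be a neighbourhood of [x], on which the kernel is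
    not integrable for [alpha <= 0]; the deficit does not depend on it. *)
Lemma Rintegral_deficit alpha Omega N x r :
  measurable Omega -> measurable N -> N `<=` Omega -> N `<=` euclid_ball x r ->
  mu.-integrable (Omega `\` N) (EFin \o pair_energy alpha x) ->
  mu.-integrable (euclid_ball x r `\` N) (EFin \o pair_energy alpha x) ->
  \int[mu]_(y in Omega `\` N) pair_energy alpha x y =
  \int[mu]_(y in euclid_ball x r `\` N) pair_energy alpha x y -
  energy_deficit alpha Omega x r.
Proof.
move=> mO mN NO NB iO iB; have mB := measurable_euclid_ball x r.
have split_ (A B : set 'rV[R]_n) : measurable A -> measurable B -> N `<=` A -> N `<=` B ->
    mu.-integrable (A `\` N) (EFin \o pair_energy alpha x) ->
    \int[mu]_(y in A `\` N) pair_energy alpha x y =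
    \int[mu]_(y in (A `&` B) `\` N) pair_energy alpha x y +
    \int[mu]_(y in A `\` B) pair_energy alpha x y.
  move=> mA mB' NA NB' iA.
  have AE : A `\` N = ((A `&` B) `\` N) `|` (A `\` B).
    apply/seteqP; split => y.
      by move=> [Ay yN]; have [By|By] := pselect (B y); [left|right].
    move=> [[[]]//|[Ay By]]; split => // /NB'; exact: By.
  rewrite [in LHS]AE Rintegral_setU//.
  - by apply: measurableD => //; exact: measurableI.
  - exact: measurableD.
  - by rewrite -AE.
  - by apply/disj_setPS => y [[[_ By] _] [_]].
rewrite (split_ Omega (euclid_ball x r))// (split_ (euclid_ball x r) Omega)//.
by rewrite [in RHS](setIC _ Omega) /energy_deficit; ring.
Qed.

End comparison.

(** * Bodies that differ from a ball by null sets *)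

Section null_bodies.
Context {R : realType}.
Variable n : nat.
Implicit Types (x y c : 'rV[R]_n) (U Omega : set 'rV[R]_n) (r : R).
Notation mu := (lebesgue_rV R n).

Lemma open_null_set0 U : open U -> mu U = 0%E -> U = set0.
Proof.
move=> oU U0; apply/seteqP; split => // y Uy.
have /nbhs_euclid_ball[s s0 sU] : nbhs y U by exact: open_nbhs_nbhs.
have : mu (euclid_ball y s) = 0%E.
  apply: (subset_measure0 _ _ sU U0); first exact: measurable_euclid_ball.
  exact: open_measurable_rV.
rewrite lebesgue_rV_euclid_ball_gt0// => -[] /eqP.
by rewrite gt_eqF// mulr_gt0 ?unit_ball_volume_gt0// exprn_gt0.
Qed.

(** A point of the closed ball is approached along the segment to the centre. *)
Lemma closure_open_euclid_ball c r : 0 < r ->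
  euclid_ball c r `<=` closure [set y | euclid_norm (c - y) < r].
Proof.
rewrite euclid_ballE => r0 y /= yr V /nbhs_euclid_ball[s s0 sV].
pose d := Num.min (2^-1) (s / r).
have d0 : 0 < d by rewrite lt_min invr_gt0 ltr0n divr_gt0.
have d1 : d < 1 by rewrite gt_min invf_lt1 ?ltr1n.
exists (y + d *: (c - y)); split => /=.
  have -> : c - (y + d *: (c - y)) = (1 - d) *: (c - y).
    by rewrite scalerBl scale1r opprD addrA.
  rewrite euclid_normZ gtr0_norm ?subr_gt0//.
  apply: (@le_lt_trans _ _ ((1 - d) * r)); first by rewrite ler_wpM2l// subr_ge0 ltW.
  by rewrite mulrBl mul1r ltrBlDr ltrDl mulr_gt0.
apply: sV; rewrite /euclid_ball /= addrAC subrr add0r euclid_normZ gtr0_norm//.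
apply: (@le_trans _ _ (d * r)); first by rewrite ler_wpM2l// ltW.
by rewrite -ler_pdivlMr// ge_min lexx orbT.
Qed.

(** [U] minus [C] is open and null, and nonempty open sets have positive
    measure. *)
Lemma open_sub_closed_null U (A C : set 'rV[R]_n) :
  open U -> U `<=` A -> measurable A -> closed C -> mu (A `\` C) = 0%E -> U `<=` C.
Proof.
move=> oU UA mA cC AC0.
have oUC : open (U `\` C) by apply: openI => //; rewrite openC.
apply/subsets_disjoint/(open_null_set0 oUC).
apply: (subset_measure0 _ _ _ AC0).
- exact: open_measurable_rV.
- by apply: measurableD => //; exact: closed_measurable_rV.
- by move=> y [/UA].
Qed.

(** Both sets are closures of open sets: the interior of Omega lies in the ball
    and the open ball lies in Omega. This is the step that uses that a body is
    the closure of its interior. *)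
Lemma body_null_eq_ball Omega c r : 0 < r -> body Omega ->
  mu (Omega `\` euclid_ball c r) = 0%E ->
  mu (euclid_ball c r `\` Omega) = 0%E ->
  Omega = euclid_ball c r.
Proof.
move=> r0 [_ OE] OB BO.
have clO : closed Omega by rewrite OE; exact: closed_closure.
have clB : closed (euclid_ball c r) by exact: closed_euclid_ball.
have mO : measurable Omega by exact: closed_measurable_rV.
have mB : measurable (euclid_ball c r) by exact: measurable_euclid_ball.
apply/seteqP; split.
  rewrite OE [X in _ `<=` X](closure_id _).1//; apply: closureS.
  apply: (open_sub_closed_null _ _ mO clB OB); first exact: open_interior.
  exact: interior_subset.
apply: (subset_trans (closure_open_euclid_ball r0)).
rewrite [X in _ `<=` X](closure_id _).1//; apply: closureS.
apply: (open_sub_closed_null _ _ mB clO BO); first exact: open_euclid_ball.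
by rewrite euclid_ballE => y /ltW.
Qed.

End null_bodies.

(** * Potentials of bodies and of balls *)

Section signed_potential.
Context {R : realType}.
Variable n : nat.
Hypothesis n1 : (1 < n)%N.
Let n0 : (0 < n)%N. Proof. exact: ltnW. Qed.
Implicit Types (x y c : 'rV[R]_n) (Omega : set 'rV[R]_n) (alpha r : R).
Notation mu := (lebesgue_rV R n).

(** With this sign every case of the extremal problem is a maximization over
    [potential_domain]. *)
Definition signed_potential alpha Omega x : R :=
  if n%:R < alpha then - potential alpha Omega x
  else if alpha == n%:R then log_potential Omega x
  else potential alpha Omega x.

Definition potential_domain alpha Omega : set 'rV[R]_n :=
  if 0 < alpha then setT else interior Omega.

Lemma is_MmE alpha Omega v : is_Mm alpha Omega v <->
  is_max_value (potential_domain alpha Omega) (signed_potential alpha Omega)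
    (if n%:R < alpha then - v else v).
Proof.
rewrite /is_Mm /potential_domain /signed_potential.
have nR0 : 0 < n%:R :> R by rewrite ltr0n.
have [na|an|an] := ltgtP n%:R alpha.
- rewrite (lt_trans nR0 na); split => -[[x _ xv] h]; split.
  + by exists x => //; rewrite xv.
  + by move=> y _; rewrite lerN2 h.
  + by exists x => //; apply: oppr_inj.
  + by move=> y _; rewrite -lerN2 h.
- by case: ifP.
- by rewrite -an nR0.
Qed.

(** The signed potential of a ball of radius [r] at its centre. For
    [alpha <= 0] this is what remains of [annulus_energy] when its part depending
    on the inner radius is cancelled by the counterterm. *)
Definition ball_potential alpha r : R :=
  if alpha == 0 then sphere_area n * ln r
  else if alpha < 0 then sphere_area n / alpha * r `^ alpha
  else \int[mu]_(y in euclid_ball 0 r) pair_energy alpha (0 : 'rV[R]_n) y.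

(** The content coordinate removes the dependence on the centre of the ball. *)
Lemma Rintegral_pair_energy_ball alpha x r : 0 < alpha -> 0 < r ->
  \int[mu]_(y in euclid_ball x r) pair_energy alpha x y =
  \int[lebesgue_measure]_(u in `[0, unit_ball_volume n * r ^+ n])
    riesz_kernel n alpha (content_radius n u).
Proof.
move=> a0 r0; pose D : set (measurableTypeR R) := `[0, unit_ball_volume n * r ^+ n]%classic.
pose f u : \bar R := (riesz_kernel n alpha (content_radius n u))%:E.
have BE : euclid_ball x r = ball_content x @^-1` D.
  rewrite euclid_ballE; apply/seteqP; split => y; rewrite /D /= in_itv/= ball_content_ge0/=;
    by rewrite (ler_ball_content n0 _ _ (ltW r0)).
have fE : (fun y => (pair_energy alpha x y)%:E) = f \o ball_content x.
  by apply/funext => y; rewrite /f /= ball_contentK.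
congr (fine _); rewrite BE fE; apply: (integral_content n0).
- exact: measurable_itv.
- by move=> u; rewrite /D /= !in_itv/= andbT => /andP[].
- apply/measurable_EFinP; apply: (measurableT_comp (measurable_riesz_kernel n alpha)).
  exact: measurable_content_radius.
- by rewrite -BE -fE; exact: integrable_pair_energy_ball.
Qed.

Lemma signed_potential_integral alpha Omega x : 0 < alpha -> compact Omega ->
  signed_potential alpha Omega x = \int[mu]_(y in Omega) pair_energy alpha x y.
Proof.
move=> a0 cO.
have mO : measurable Omega.
  by apply: closed_measurable_rV; apply: compact_closed => //; exact: norm_hausdorff.
have [r r0 Or] := compact_sub_euclid_ball x cO.
have iO : mu.-integrable Omega (EFin \o pair_energy alpha x).
  apply: integrableS (integrable_pair_energy_ball n1 x a0 r0) => //.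
  exact: measurable_euclid_ball.
have negE (f : 'rV[R]_n -> R) : (forall y, pair_energy alpha x y = - f y) ->
    - (\int[mu]_(y in Omega) f y) = \int[mu]_(y in Omega) pair_energy alpha x y.
  move=> fE; rewrite -mulN1r -RintegralZl//.
    by apply: eq_Rintegral => y _; rewrite mulN1r fE.
  apply: eq_integrable (integrableN iO) => // y _ /=.
  by rewrite fE opprK.
rewrite /signed_potential /potential /log_potential leNgt a0/=.
case: ifPn => [na|na]; first by apply: negE => y; rewrite /pair_energy /riesz_kernel na.
case: ifPn => [an|an].
  by apply: negE => y; rewrite /pair_energy /riesz_kernel (negbTE na) an.
by apply: eq_Rintegral => y _; rewrite /pair_energy /riesz_kernel (negbTE na) (negbTE an).
Qed.

(** For [alpha <= 0] the renormalized quantity is constant for small [e]: the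
    removed ball is common to Omega and to the comparison ball, and
    [integral_annulus] evaluates what is left of the latter. *)
Lemma signed_potential_deficit alpha Omega x r : compact Omega -> 0 < r ->
  mu Omega = mu (euclid_ball x r) -> potential_domain alpha Omega x ->
  [/\ signed_potential alpha Omega x = ball_potential alpha r - energy_deficit alpha Omega x r,
      0 <= energy_deficit alpha Omega x r &
      energy_deficit alpha Omega x r = 0 ->
      mu (Omega `\` euclid_ball x r) = 0%E /\ mu (euclid_ball x r `\` Omega) = 0%E].
Proof.
move=> cO r0 vol; rewrite /potential_domain.
have mO : measurable Omega.
  by apply: closed_measurable_rV; apply: compact_closed => //; exact: norm_hausdorff.
have mB := measurable_euclid_ball x r.
have [s s0 Os] := compact_sub_euclid_ball x cO.
case: ifPn => [a0 _|].
  have iO : mu.-integrable Omega (EFin \o pair_energy alpha x).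
    apply: integrableS (integrable_pair_energy_ball n1 x a0 s0) => //.
    exact: measurable_euclid_ball.
  have iB := integrable_pair_energy_ball n1 x a0 r0.
  have [D0 Dnull] : 0 <= energy_deficit alpha Omega x r /\ (energy_deficit alpha Omega x r = 0 ->
      mu (Omega `\` euclid_ball x r) = 0%E /\ mu (euclid_ball x r `\` Omega) = 0%E).
    apply: energy_deficit_ge0 => //.
    - by apply: integrableS iO => //; exact: measurableD.
    - by apply: integrableS iB => //; exact: measurableD.
  split => //; rewrite signed_potential_integral// /ball_potential gt_eqF// ltNge ltW//=.
  rewrite (Rintegral_pair_energy_ball 0)// -(Rintegral_pair_energy_ball x)//.
  have := @Rintegral_deficit R n alpha Omega set0 x r mO measurable0.
  by rewrite !setD0; apply.
rewrite -leNgt => a0 xO; have [e e0 eO] := nbhs_euclid_ball xO.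
have away A : measurable A -> A `<=` euclid_ball x (Num.max r s) -> forall d, 0 < d ->
    mu.-integrable (A `\` euclid_ball x d) (EFin \o pair_energy alpha x).
  move=> mA AB d d0; apply: (@integrable_pair_energy_away R n n1 alpha x _ (Num.max r s) d) => //.
    by apply: measurableD => //; exact: measurable_euclid_ball.
  by move=> y [/AB].
have OM : Omega `<=` euclid_ball x (Num.max r s).
  by move=> y /Os; rewrite /euclid_ball /= => /le_trans; apply; rewrite le_max lexx orbT.
have BM : euclid_ball x r `<=` euclid_ball x (Num.max r s).
  by move=> y; rewrite /euclid_ball /= => /le_trans; apply; rewrite le_max lexx.
have iOd := away _ mO OM.
have iBd := away _ mB BM.
have [D0 Dnull] : 0 <= energy_deficit alpha Omega x r /\ (energy_deficit alpha Omega x r = 0 ->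
    mu (Omega `\` euclid_ball x r) = 0%E /\ mu (euclid_ball x r `\` Omega) = 0%E).
  apply: energy_deficit_ge0 => //.
  - exact: iOd.
  - apply: integrableS (iBd _ e0).
    + by apply: measurableD => //; exact: measurable_euclid_ball.
    + exact: measurableD.
    + by move=> y [yB yO]; split => // /eO.
split => //.
have nR0 : 0 < n%:R :> R by rewrite ltr0n.
have an : alpha < n%:R by exact: le_lt_trans nR0.
have pE y : euclid_norm (x - y) `^ (alpha - n%:R) = pair_energy alpha x y.
  by rewrite /pair_energy /riesz_kernel ltNge ltW//= lt_eqF.
have -> : signed_potential alpha Omega x = potential alpha Omega x.
  by rewrite /signed_potential ltNge ltW//= lt_eqF.
rewrite /potential a0 /= mem_set//.
apply/cvg_lim => //.
apply: (@cvg_trans _ ((fun=> ball_potential alpha r -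
  energy_deficit alpha Omega x r) @ 0^'+)); last exact: cvg_cst.
apply: near_eq_cvg; near=> d.
have d0 : 0 < d by near: d; exact: nbhs_right_gt.
have de : d < e by near: d; exact: nbhs_right_lt.
have dr : d < r by near: d; exact: nbhs_right_lt.
have ballS t : d < t -> euclid_ball x d `<=` euclid_ball x t.
  by move=> dt y; rewrite /euclid_ball /= => /le_trans; apply; exact: ltW.
rewrite /riesz_integral.
under eq_Rintegral do rewrite pE.
rewrite (@Rintegral_deficit R n alpha Omega _ x r)//; last 5 first.
- exact: measurable_euclid_ball.
- exact: subset_trans (ballS _ de) eO.
- exact: ballS.
- exact: iOd.
- exact: iBd.
rewrite addrAC; congr (_ - _).
under eq_Rintegral do rewrite -pE.
rewrite /Rintegral integral_annulus//= /annulus_energy /counterterm /ball_potential.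
have [_|aN0] := eqVneq alpha 0.
  by rewrite div1r lnV ?posrE//; ring.
have alt0 : alpha < 0 by rewrite lt_neqAle aN0.
by rewrite alt0 powRN div1r invrK; field.
Unshelve. all: by end_near. Qed.

End signed_potential.

(** * The extremal inequality *)

Lemma sup_norm_le_euclid_norm (R : realType) n (x : 'rV[R]_n) :
  `|x| <= euclid_norm x.
Proof.
rewrite [leLHS]mx_normrE; apply/bigmax_leP; split; first exact: euclid_norm_ge0.
by move=> [i j] _ /=; rewrite (ord1 i); exact: coord_le_euclid_norm.
Qed.

Lemma compact_euclid_ball (R : realType) n (c : 'rV[R]_n) r :
  compact (euclid_ball c r).
Proof.
apply: bounded_closed_compact; last exact: closed_euclid_ball.
exists (`|c| + r); split; first exact: num_real.
move=> M cM y yr; apply: le_trans (ltW cM).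
rewrite -[y](subrK c) (le_trans (ler_normD _ _))// addrC lerD2l.
exact: le_trans (sup_norm_le_euclid_norm _) yr.
Qed.

Theorem proposition3p7 (R : realType) (m : nat) (hm : (2 <= m)%N)
    (Omega B : set 'rV[R]_m) (alpha MOmega : R)
    (hbody : body Omega) (hC1 : piecewise_C1_boundary Omega)
    (hMm : is_Mm alpha Omega MOmega)
    (hB : is_euclid_ball B) (hvol : lebesgue_rV R m Omega = lebesgue_rV R m B) :
  exists MB : R,
    [/\ is_Mm alpha B MB,
        m%:R < alpha -> MB <= MOmega,
        alpha <= m%:R -> MOmega <= MB &
        MOmega = MB <-> is_euclid_ball Omega].
Proof.
have [c [r [r0 BE]]] := hB.
have m0 : (0 < m)%N by exact: ltnW.
have volB x : lebesgue_rV R m B = lebesgue_rV R m (euclid_ball x r).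
  by rewrite BE !lebesgue_rV_euclid_ball_gt0.
pose sgn (v : R) := if m%:R < alpha then - v else v.
have sgnK : involutive sgn.
  by move=> v; rewrite /sgn; case: ltP => _; rewrite ?opprK.
pose W := ball_potential m alpha r.
have ball_pot (x : 'rV[R]_m) : signed_potential alpha (euclid_ball x r) x = W.
  have xD : potential_domain alpha (euclid_ball x r) x.
    by rewrite /potential_domain; case: ifP => // _; exact: interior_euclid_ball.
  have [-> _ _] := signed_potential_deficit hm (@compact_euclid_ball R m x r) r0 erefl xD.
  by rewrite /energy_deficit !setDv Rintegral_set0 subrr subr0.
(* [MOmega] is attained at [x0], the centre of the comparison ball. *)
have [[x0 x0D x0M] MOmega_max] := (is_MmE hm _ _ _).1 hMm.
rewrite -/(sgn MOmega) in x0M MOmega_max.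
have volO x : lebesgue_rV R m Omega = lebesgue_rV R m (euclid_ball x r).
  by rewrite hvol.
have [potO D0 Dnull] := signed_potential_deficit hm hbody.1 r0 (volO x0) x0D.
rewrite -/W x0M in potO.
have MW : sgn MOmega <= W by rewrite potO lerBlDr lerDl.
exists (sgn W); split.
- apply/(is_MmE hm); rewrite -/(sgn (sgn W)) sgnK BE; split.
    exists c => //; rewrite /potential_domain; case: ifP => // _.
    exact: interior_euclid_ball.
  move=> x xD.
  have vol : lebesgue_rV R m (euclid_ball c r) = lebesgue_rV R m (euclid_ball x r).
    by rewrite -BE.
  have [-> xD0 _] := signed_potential_deficit hm (@compact_euclid_ball R m c r) r0 vol xD.
  by rewrite lerBlDr lerDl.
- by move=> ma; move: MW; rewrite /sgn ma => MW; rewrite lerNl.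
- by move=> am; move: MW; rewrite /sgn ltNge am.
split=> [MB|[c' [r' [r'0 OE]]]].
  have D00 : energy_deficit alpha Omega x0 r = 0.
    apply/eqP; rewrite -[_ == 0](inj_eq oppr_inj) oppr0 -(inj_eq (addrI W)) addr0.
    by rewrite -potO MB sgnK.
  have [OB BO] := Dnull D00.
  by exists x0, r; split => //; exact: body_null_eq_ball.
(* If Omega is itself a ball, its centre is a competitor with the value [W]. *)
have r'E : r' = r.
  move: (volO c'); rewrite OE !lebesgue_rV_euclid_ball_gt0// => -[].
  move/(mulfI (lt0r_neq0 (unit_ball_volume_gt0 m))) => rr.
  by apply: (pexpIrn m0) => //; rewrite nnegrE ltW.
apply: (inv_inj sgnK); rewrite sgnK; apply/eqP; rewrite eq_le MW /=.
rewrite -(ball_pot c') -{1}r'E -OE; apply: MOmega_max.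
rewrite /potential_domain; case: ifP => // _; rewrite OE.
exact: interior_euclid_ball.
Qed.
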